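(* Let $\Omega\subset\mathbf{R}^3$ be a bounded region with smooth ($C^\infty$) boundary and let $K$ be its double layer potential on $L^2(\partial\Omega)$, with ordered eigenvalues $\lambda_j$. Then for every $\alpha>-\frac12$, $$\lambda_j=o(j^{\alpha})\qquad\text{as } j\to\infty.$$
   Context: For a bounded region $\Omega\subset\mathbf{R}^3$ with (at least) $C^2$ boundary, the double layer potential is the compact operator $K:L^2(\partial\Omega)\to L^2(\partial\Omega)$, $(K\psi)(x)=\int_{\partial\Omega}\psi(y)\,\nu_yE(x,y)\,ds_y$, where $E(x,y)=\frac{1}{2\pi}\frac{1}{|x-y|}$, $ds_y$ is the surface element, and $\nu_y$ denotes the outer normal derivative on $\partial\Omega$ in the variable $y$. The eigenvalues of $K$, counted with multiplicity, are ordered by nonincreasing modulus $|\lambda_0|\ge|\lambda_1|\ge|\lambda_2|\ge\cdots$; it is assumed that there are infinitely many eigenvalues counted with multiplicity. *)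

(* Defs.v *)
From HB Require Import structures.
From mathcomp Require Import all_boot all_order all_algebra.
From mathcomp Require Import complex.
From mathcomp Require Import all_classical all_reals all_analysis.

Set Implicit Arguments.
Unset Strict Implicit.
Unset Printing Implicit Defensive.

Import Order.TTheory GRing.Theory Num.Theory.
Import numFieldNormedType.Exports.

Local Open Scope classical_set_scope.
Local Open Scope complex_scope.
Local Open Scope ring_scope.

Section Geometry.
Variable R : realType.

(* Borel sigma-algebra; the carrier is convertible to 'rV[R]_3. *)
Definition borel3 := g_sigma_algebraType (@open 'rV[R]_3).

(* The library norm on 'rV[R]_n is the sup norm. *)
Definition enorm n (x : 'rV[R]_n) : R := Num.sqrt (\sum_i x 0 i ^+ 2).

Definition boundary (A : set 'rV[R]_3) : set 'rV[R]_3 := closure A `\` interior A.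

Definition region (Omega : set 'rV[R]_3) : Prop :=
  [/\ Omega !=set0, open Omega & connected Omega].

(* C^infty on the whole space: differentiability of all iterated directional
   derivatives also gives their continuity. *)
Definition smooth (V W : normedModType R) (f : V -> W) : Prop :=
  forall (vs : seq V) (x : V),
    differentiable (foldr (fun v h => 'D_v h) f vs) x.

Definition vec3 (a b c : R) : 'rV[R]_3 := \row_i nth 0 [:: a; b; c] i.

(* Q is the orthogonal matrix of a rotated coordinate system: a point with new
   coordinates w is w *m Q. *)
Definition rotated_coord (Q : 'M[R]_3) (x : 'rV[R]_3) (i : 'I_3) : R :=
  (x *m Q^T) 0 i.

Definition base_point (Q : 'M[R]_3) (x : 'rV[R]_3) : R * R :=
  (rotated_coord Q x 0, rotated_coord Q x 1).

Definition graph_map (Q : 'M[R]_3) (g : R * R -> R) (u : R * R) : 'rV[R]_3 :=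
  vec3 u.1 u.2 (g u) *m Q.

Definition dg1 (g : R * R -> R) (u : R * R) : R := 'D_((1, 0) : R * R) g u.
Definition dg2 (g : R * R -> R) (u : R * R) : R := 'D_((0, 1) : R * R) g u.

Definition area_density (g : R * R -> R) (u : R * R) : R :=
  Num.sqrt (1 + dg1 g u ^+ 2 + dg2 g u ^+ 2).

(* In the Euclidean ball of radius r about p, Omega is the part lying strictly
   below the graph of the smooth function g, in the coordinates given by Q. *)
Definition graph_chart (Omega : set 'rV[R]_3) (p : 'rV[R]_3) (r : R)
    (Q : 'M[R]_3) (g : R * R -> R) : Prop :=
  [/\ 0 < r, Q *m Q^T = 1%:M, smooth g &
      forall x, enorm (x - p) < r ->
        (Omega x <-> rotated_coord Q x 2%:R < g (base_point Q x))].

Definition smooth_boundary (Omega : set 'rV[R]_3) : Prop :=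
  forall p, boundary Omega p -> exists r Q g, graph_chart Omega p r Q g.

(* Omega lies below the graph, so the upward unit normal of the graph is the
   outer one. *)
Definition outer_normal (Omega : set 'rV[R]_3) (nu : 'rV[R]_3 -> 'rV[R]_3) :
    Prop :=
  forall p r Q g, boundary Omega p -> graph_chart Omega p r Q g ->
  forall y, boundary Omega y -> enorm (y - p) < r ->
    let u := base_point Q y in
    nu y = (area_density g u)^-1 *: (vec3 (- dg1 g u) (- dg2 g u) 1 *m Q).

(* The measure carried by the boundary whose expression in each graph chart is
   ds = sqrt (1 + |grad g|^2) du. *)
Definition surface_measure (Omega : set 'rV[R]_3)
    (sigma : {measure set borel3 -> \bar R}) : Prop :=
  sigma (~` boundary Omega) = 0%E /\
  forall p r Q g, boundary Omega p -> graph_chart Omega p r Q g ->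
  forall A : set borel3, measurable A ->
    A `<=` boundary Omega -> (forall x, A x -> enorm (x - p) < r) ->
    sigma A = (\int[lebesgue_measure \x lebesgue_measure]_(u in
                 graph_map Q g @^-1` A) (area_density g u)%:E)%E.

End Geometry.

Section Spectrum.
Context {d : measure_display} {X : measurableType d} {R : realType}.
Variable mu : {measure set X -> \bar R}.

Definition cintegral (D : set X) (f : X -> R[i]) : R[i] :=
  (\int[mu]_(x in D) complex.Re (f x)) +i* (\int[mu]_(x in D) complex.Im (f x)).

(* Representatives of the elements of the complex space L^2(mu); below,
   equality in L^2 is equality almost everywhere. *)
Definition L2 (psi : X -> R[i]) : Prop :=
  (fun x => complex.Re (psi x)) \in Lfun mu 2%:E /\
  (fun x => complex.Im (psi x)) \in Lfun mu 2%:E.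

Variable T : (X -> R[i]) -> (X -> R[i]).

Definition generalized_eigenvector (c : R[i]) (psi : X -> R[i]) : Prop :=
  L2 psi /\
  exists n, {ae mu, forall x,
    iter n (fun phi x => T phi x - c * phi x) psi x = 0}.

(* The algebraic multiplicity of c (the dimension in L^2 of its generalized
   eigenspace, possibly infinite) is at least m. *)
Definition multiplicity_ge (c : R[i]) (m : nat) : Prop :=
  exists psi : 'I_m -> X -> R[i],
    (forall i, generalized_eigenvector c (psi i)) /\
    (forall a : 'I_m -> R[i],
       {ae mu, forall x, \sum_i a i * psi i x = 0} -> forall i, a i = 0).

(* lam lists the eigenvalues by nonincreasing modulus, each nonzero one exactly
   as often as its multiplicity. The value 0 can occur only once all the nonzero
   eigenvalues are exhausted, and at most as often as its multiplicity. *)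
Definition ordered_eigenvalues (lam : nat -> R[i]) : Prop :=
  [/\ forall i j, (i <= j)%N -> `|lam j| <= `|lam i|,
      forall c n, multiplicity_ge c (count_mem c (mkseq lam n)) &
      forall c m, c != 0 -> multiplicity_ge c m ->
        exists n, (m <= count_mem c (mkseq lam n))%N].

End Spectrum.

Section DoubleLayer.
Variable R : realType.

Definition newton (x y : 'rV[R]_3) : R := (2 * pi)^-1 * (enorm (x - y))^-1.

Definition double_layer (Omega : set 'rV[R]_3) (nu : 'rV[R]_3 -> 'rV[R]_3)
    (sigma : {measure set (borel3 R) -> \bar R}) (psi : borel3 R -> R[i]) :
    borel3 R -> R[i] :=
  fun x => cintegral sigma (boundary Omega)
    (fun y => psi y * ('D_(nu y) (newton x) y)%:C).

End DoubleLayer.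

(* Main.v *)
Require Import Defs.
From HB Require Import structures.
From mathcomp Require Import all_boot all_order all_algebra finmap.
From mathcomp Require Import complex.
From mathcomp Require Import all_classical all_reals all_analysis.
From mathcomp Require Import measurable_realfun ring lra.

(** The kernel of K is bounded by M/|x - y| on the boundary, because the part
    of x - y normal to the surface at y is quadratic in |x - y|, and the surface
    measure of a ball of radius r is at most C r^2.  Cut the kernel at distance
    2^-m.  The far part is Hilbert-Schmidt with squared norm O(1 + m), and by
    the Schur test the near part has operator norm O(2^-m).  The generalized
    eigenvectors of the eigenvalues lambda_0, ..., lambda_n span a K-invariant
    space of dimension N > n with an orthonormal basis (e_i) in which K is upper
    triangular, so that
      N |lambda_n|^2 <= sum_i |<K e_i, e_i>|^2 <= sum_i |K e_i|^2
                     <= O(1 + m) + O(N 4^-m),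
    the far part being estimated by Bessel's inequality for the sections
    k(x, .).  With 4^m close to n this gives |lambda_n|^2 = O((1 + log n) / n). *)

Set Implicit Arguments.
Unset Strict Implicit.
Unset Printing Implicit Defensive.

Import Order.TTheory GRing.Theory Num.Theory.
Import numFieldNormedType.Exports.
Local Open Scope classical_set_scope.
Local Open Scope complex_scope.
Local Open Scope ring_scope.

(** * Invariant flags in a semi-inner product space *)

(** [K] is not self-adjoint, so single eigenvalues are not controlled directly by singular values; a
    triangular form puts eigenvalues on a diagonal that an orthonormal basis can read off. Functions
    are not identified modulo null sets: the integral operator acts on representatives and is linear
    only almost everywhere, a divergent integral having the default value 0. The linear algebra is
    therefore done in a semi-inner product space, with span, linearity and triangularity all
    understood modulo null vectors. Finitely many generalized eigenvectors need not span an
    invariant space, so the basis also takes in their orbits under T - z. Its length N is then known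
    only from below. This does no harm: every diagonal entry is one of lambda_0, ..., lambda_n, and
    the near part costs the same for each basis vector. The logarithm comes from dyadic shells: each
    of the m shells between the radii 2^-m and 1 adds a bounded amount to the squared norm of a
    section of the kernel. *)

Lemma uniform_threshold (I : eqType) (L : seq I) (P : I -> nat -> Prop) :
  (forall p, p \in L -> exists n, forall m, (n <= m)%N -> P p m) ->
  exists M, forall p, p \in L -> P p M.
Proof.
move=> h; suff [M hM] : exists M, forall p, p \in L ->
    forall m, (M <= m)%N -> P p m by exists M => p /hM; apply.
elim: L h => [|q L IH] h; first by exists 0%N.
have [p pL|M hM] := IH; first by apply: h; rewrite inE pL orbT.
have [n hn] := h _ (mem_head q L).
exists (maxn n M) => p; rewrite inE => /orP[/eqP->|pL] m; rewrite geq_max => /andP[nm Mm].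
  exact: hn.
exact: hM.
Qed.

Section SemiInner.
Variables (C : numClosedFieldType) (V : lmodType C) (ip : V -> V -> C).

Definition semi_inner : Prop :=
  [/\ forall a u v w, ip (a *: u + v) w = a * ip u w + ip v w,
      forall u v, ip v u = (ip u v)^* &
      forall u, 0 <= ip u u].

Hypothesis ip_si : semi_inner.

Let ipP a u v w : ip (a *: u + v) w = a * ip u w + ip v w.
Proof. by case: ip_si. Qed.
Let ipC u v : ip v u = (ip u v)^*. Proof. by case: ip_si. Qed.
Let ip_ge0 u : 0 <= ip u u. Proof. by case: ip_si. Qed.

Definition nullv v := ip v v = 0.

Lemma ip0l v : ip 0 v = 0.
Proof. by have := ipP (-1) 0 0 v; rewrite scaler0 addr0 mulN1r addNr. Qed.

Lemma ipZl a u v : ip (a *: u) v = a * ip u v.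
Proof. by rewrite -[a *: u]addr0 ipP ip0l addr0. Qed.

Lemma ipDl u v w : ip (u + v) w = ip u w + ip v w.
Proof. by rewrite -[u in LHS]scale1r ipP mul1r. Qed.

Lemma ipBl u v w : ip (u - v) w = ip u w - ip v w.
Proof. by rewrite ipDl -scaleN1r ipZl mulN1r. Qed.

Lemma ip_suml I (r : seq I) (P : pred I) F v :
  ip (\sum_(i <- r | P i) F i) v = \sum_(i <- r | P i) ip (F i) v.
Proof.
by apply: (big_morph (fun u => ip u v)) => [u w|]; [exact: ipDl|exact: ip0l].
Qed.

Lemma ip0r v : ip v 0 = 0. Proof. by rewrite ipC ip0l conjC0. Qed.
Lemma ipZr a u v : ip u (a *: v) = a^* * ip u v.
Proof. by rewrite ipC ipZl rmorphM /= -ipC. Qed.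
Lemma ipDr u v w : ip u (v + w) = ip u v + ip u w.
Proof. by rewrite ipC ipDl rmorphD /= -!ipC. Qed.
Lemma ipBr u v w : ip u (v - w) = ip u v - ip u w.
Proof. by rewrite ipC ipBl rmorphB /= -!ipC. Qed.
Lemma ip_sumr I (r : seq I) (P : pred I) F v :
  ip v (\sum_(i <- r | P i) F i) = \sum_(i <- r | P i) ip v (F i).
Proof.
by apply: (big_morph (fun u => ip v u)) => [u w|]; [exact: ipDr|exact: ip0r].
Qed.

(** The degenerate case of the Cauchy-Schwarz inequality: if a = <u, v> were nonzero, moving [v]
    along [u] would change its square norm linearly, as [u] adds no quadratic term, and could make
    it negative. *)
Lemma null_ipl u v : nullv u -> ip u v = 0.
Proof.
move=> u0; apply/eqP/negPn/negP => a0.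
pose a := ip u v.
have na : 0 < `|a| ^+ 2 by rewrite exprn_gt0 // normr_gt0.
have vr : ip v v \is Num.real by apply: ger0_real.
(* Chosen so that the square norm below becomes <v, v> - 2 (<v, v> + 1), which is negative. *)
pose s := (ip v v + 1) / `|a| ^+ 2.
have := ip_ge0 ((- s * a^*) *: u + v).
have sr : s^* = s.
  by apply/CrealP; rewrite rpredM ?rpredD ?rpredV ?rpred1 //; apply: gtr0_real.
rewrite ipP.
have -> : ip u ((- s * a^*) *: u + v) = a.
  by rewrite ipDr ipZr u0 mulr0 add0r.
rewrite ipDr ipZr -/a [ip v u]ipC -/a rmorphM rmorphN /= conjCK sr.
have -> : - s * a^* * a + (- s * a * a^* + ip v v) = ip v v - 2 * s * (a * a^*).
  by ring.
rewrite -normCK /s -mulrA divfK ?gt_eqF // => h.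
have : ip v v - 2 * (ip v v + 1) < 0.
  rewrite subr_lt0 mulrDr mulr1 mulr_natl mulr2n -addrA ltrDl.
  by rewrite ltr_wpDl.
by move=> /lt_geF; rewrite h.
Qed.

Lemma null_lin a u v : nullv u -> nullv v -> nullv (a *: u + v).
Proof. by move=> u0 v0; rewrite /nullv ipP !null_ipl // mulr0 addr0. Qed.

Lemma null0 : nullv 0. Proof. exact: ip0l. Qed.

Definition linear_set (S : V -> Prop) :=
  S 0 /\ forall a u v, S u -> S v -> S (a *: u + v).

Lemma linear_setD S u v : linear_set S -> S u -> S v -> S (u + v).
Proof. by case=> _ h hu hv; rewrite -[u]scale1r; apply: h. Qed.

Lemma linear_setZ S a u : linear_set S -> S u -> S (a *: u).
Proof. by case=> h0 h hu; rewrite -[_ *: _]addr0; apply: h. Qed.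

Lemma linear_setB S u v : linear_set S -> S u -> S v -> S (u - v).
Proof.
by move=> lS hu hv; apply: linear_setD => //; rewrite -scaleN1r; apply: linear_setZ.
Qed.

Lemma linear_set_sum S n (F : nat -> V) : linear_set S ->
  (forall j, (j < n)%N -> S (F j)) -> S (\sum_(j < n) F j).
Proof.
move=> lS hF; elim/big_ind: _ => [|u v|[j lj] _]; first by case: lS.
  exact: linear_setD.
exact: hF.
Qed.

(** Indexed by [nat] and cut at [N], so that a prefix of a family and its extension by one vector
    keep the same type. *)
Definition orthonormal_seq N (e : nat -> V) :=
  forall i j, (i < N)%N -> (j < N)%N -> ip (e i) (e j) = (i == j)%:R.

Definition proj N (e : nat -> V) v := \sum_(j < N) ip v (e j) *: e j.
Definition resid N e v := v - proj N e v.
(** The span of the first [N] vectors modulo null vectors, with no quotient: for an orthonormal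
    family, [v] lies in it exactly when its orthogonal projection leaves a null remainder. *)
Definition ae_span N e v := nullv (resid N e v).

Lemma resid_lin N e a u v : resid N e (a *: u + v) = a *: resid N e u + resid N e v.
Proof.
rewrite /resid /proj scalerBr scaler_sumr addrACA -opprD -big_split /=.
by congr (_ - _); apply: eq_bigr => j _; rewrite ipP scalerDl scalerA.
Qed.

Lemma ae_span_linear N e : linear_set (ae_span N e).
Proof.
split=> [|a u v hu hv]; last by rewrite /ae_span resid_lin; exact: null_lin.
rewrite /ae_span /resid /proj big1 ?subr0; first exact: null0.
by move=> j _; rewrite ip0l scale0r.
Qed.

Lemma null_ae_span N e v : nullv v -> ae_span N e v.
Proof.
move=> v0; rewrite /ae_span /resid /proj big1 ?subr0 // => j _.
by rewrite null_ipl // scale0r.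
Qed.

Lemma mem_ae_span N e j : orthonormal_seq N e -> (j < N)%N -> ae_span N e (e j).
Proof.
move=> eo lj; rewrite /ae_span /resid /proj (bigD1 (Ordinal lj)) //= eo // eqxx.
rewrite scale1r big1 ?addr0 ?subrr; first exact: null0.
move=> i /eqP ij; rewrite eo //; case: eqP => [ji|_]; last by rewrite scale0r.
by case: ij; apply: val_inj.
Qed.

Lemma resid_orth N e v j : orthonormal_seq N e -> (j < N)%N -> ip (resid N e v) (e j) = 0.
Proof.
move=> eo lj; rewrite /resid ipBl /proj ip_suml (bigD1 (Ordinal lj)) //= ipZl eo // eqxx.
rewrite mulr1 big1 ?addr0 ?subrr // => i /eqP ij.
rewrite ipZl eo //; case: eqP => [ji|_]; last by rewrite mulr0.
by case: ij; apply: val_inj.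
Qed.

(** The induction principle for [ae_span]: [v] is a null residual plus a combination of the [e j].
    Stability under [T] and the matrix of [T] are both proved through it. *)
Lemma ae_span_min N e S v : linear_set S -> (forall u, nullv u -> S u) ->
  (forall j, (j < N)%N -> S (e j)) -> ae_span N e v -> S v.
Proof.
move=> lS S0 Se hv; rewrite -[v](subrK (proj N e v)).
apply: linear_setD => //; first exact: S0.
apply: (linear_set_sum (F := fun j => ip v (e j) *: e j)) => // j lj.
by apply: linear_setZ => //; apply: Se.
Qed.

(** The defect of the inequality is the square norm of the residual. *)
Lemma bessel N e v : orthonormal_seq N e ->
  \sum_(j < N) `|ip v (e j)| ^+ 2 <= ip v v.
Proof.
move=> eo; rewrite -subr_ge0.
suff -> : ip v v - \sum_(j < N) `|ip v (e j)| ^+ 2 = ip (resid N e v) (resid N e v).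
  exact: ip_ge0.
rewrite [resid N e v in RHS]/resid ipBr.
rewrite [X in _ = _ - X](_ : _ = 0) ?subr0; last first.
  rewrite /proj ip_sumr big1 // => j _.
  by rewrite ipZr resid_orth ?mulr0.
rewrite /resid ipBl; congr (_ - _).
rewrite /proj ip_suml; apply: eq_bigr => j _.
by rewrite ipZl normCK -ipC.
Qed.

Variable T : V -> V.

(** What an integral operator on representatives satisfies. The clause on null vectors is separate
    because linearity modulo null vectors alone does not make [T] respect equality almost
    everywhere. *)
Definition ae_linear : Prop :=
  (forall u, nullv u -> nullv (T u)) /\
  (forall a u v, nullv (T (a *: u + v) - (a *: T u + T v))).

Hypothesis Tlin : ae_linear.

Let T_null u : nullv u -> nullv (T u).
Proof. exact: (proj1 Tlin). Qed.
Let T_lin a u v : nullv (T (a *: u + v) - (a *: T u + T v)).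
Proof. exact: (proj2 Tlin). Qed.

Lemma preim_ae_span N e :
  linear_set (fun v => ae_span N e (T v)).
Proof.
have lS := ae_span_linear N e.
split=> [|a u v hu hv].
  by apply: null_ae_span; exact: (T_null null0).
rewrite -[T _](subrK (a *: T u + T v)); apply: linear_setD => //.
  by apply: null_ae_span; exact: T_lin.
by case: lS => _; apply.
Qed.

(* The e_i are orthonormal and T acts on them, modulo null vectors, by an upper
   triangular matrix with diagonal c. *)
Definition flag N (e : nat -> V) (c : nat -> C) :=
  orthonormal_seq N e /\
  forall i, (i < N)%N -> ae_span i e (T (e i) - c i *: e i).

Lemma ae_spanW M N e v : orthonormal_seq N e -> (M <= N)%N ->
  ae_span M e v -> ae_span N e v.
Proof.
move=> eo MN; apply: ae_span_min; [exact: ae_span_linear|exact: null_ae_span|].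
by move=> j lj; apply: mem_ae_span => //; apply: leq_trans MN.
Qed.

Lemma flag_stable N e c v : flag N e c -> ae_span N e v -> ae_span N e (T v).
Proof.
move=> [eo tr]; apply: (ae_span_min (S := fun v => ae_span N e (T v))).
- exact: preim_ae_span.
- by move=> u u0; exact: null_ae_span (T_null u0).
move=> j lj; rewrite -[T _](subrK (c j *: e j)).
apply: linear_setD; first exact: ae_span_linear.
  by apply: (@ae_spanW j) => //; [exact: ltnW|exact: tr].
by apply: linear_setZ; [exact: ae_span_linear|exact: mem_ae_span].
Qed.

Lemma eq_ae_span N e e' v : (forall i, (i < N)%N -> e i = e' i) ->
  ae_span N e v -> ae_span N e' v.
Proof.
move=> ee'; rewrite /ae_span /resid /proj.
by rewrite (eq_bigr (fun j : 'I_N => ip v (e' j) *: e' j)) // => j _; rewrite ee'.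
Qed.

(* Induction on n puts T psi - z psi into the span; if psi is not yet there, its
   normalized residual extends the flag with diagonal entry z. *)
Lemma flag_extend (D : C -> Prop) n N e c psi z :
  flag N e c -> (forall i, (i < N)%N -> D (c i)) -> D z ->
  nullv (iter n (fun u => T u - z *: u) psi) ->
  exists N' e' c', [/\ flag N' e' c', forall i, (i < N')%N -> D (c' i),
    forall v, ae_span N e v -> ae_span N' e' v & ae_span N' e' psi].
Proof.
move=> + + Dz; elim: n psi => [|n IHn] psi fl Dc.
  by move=> psi0; exists N, e, c; split => //; exact: null_ae_span.
rewrite iterSr => /(IHn _ fl Dc) [M [f [d [flf Dd sub Sphi]]]].
have [psiS|psiS] := eqVneq (ip (resid M f psi) (resid M f psi)) 0.
  by exists M, f, d; split.
have lS := ae_span_linear M f.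
have [fo ftr] := flf.
pose r := resid M f psi; pose s := (sqrtC (ip r r))^-1.
have rr : 0 < ip r r by rewrite lt_neqAle eq_sym psiS ip_ge0.
have s0 : 0 < s by rewrite invr_gt0 sqrtC_gt0.
have sc : s^* = s by apply/CrealP; apply: gtr0_real.
have Sp : ae_span M f (proj M f psi).
  apply: (linear_set_sum (F := fun j => ip psi (f j) *: f j)) => // j lj.
  by apply: linear_setZ => //; apply: mem_ae_span.
pose g i := if i == M then s *: r else f i.
pose b i := if i == M then z else d i.
have gf i : (i < M)%N -> g i = f i by rewrite /g => /ltn_eqF ->.
have gM : g M = s *: r by rewrite /g eqxx.
have go : orthonormal_seq M.+1 g.
  move=> i j; rewrite !ltnS [(i <= M)%N]leq_eqVlt [(j <= M)%N]leq_eqVlt => /orP[/eqP->|li] /orP[/eqP->|lj].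
  - rewrite eqxx gM ipZl ipZr sc mulrA -expr2 exprVn sqrtCK.
    by rewrite mulVf.
  - by rewrite gM gf // ipZl resid_orth // mulr0 gtn_eqF.
  - by rewrite gM gf // ipZr ipC resid_orth // conjC0 mulr0 ltn_eqF.
  - by rewrite !gf // fo.
have fg v : ae_span M f v -> ae_span M.+1 g v.
  move=> h; apply: (@ae_spanW M) => //.
  by apply: eq_ae_span h => i li; rewrite gf.
exists M.+1, g, b; split.
- split=> // i; rewrite ltnS leq_eqVlt => /orP[/eqP->|li]; last first.
    rewrite gf // /b ltn_eqF //; apply: (@eq_ae_span _ f).
      by move=> j ji; rewrite gf //; apply: ltn_trans li.
    exact: ftr.
  rewrite gM /b eqxx; apply: (@eq_ae_span _ f) => [j lj|]; first by rewrite gf.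
  (* T - z sends [psi] into the span by induction, and the projection of [psi] by stability of the
     flag; hence it also sends their difference [r] there. *)
  have kernel_op : ae_span M f (T r - z *: r).
    rewrite /r /resid [psi - _]addrC.
    have -> : T (- proj M f psi + psi) - z *: (- proj M f psi + psi) =
      (T ((-1) *: proj M f psi + psi) - ((-1) *: T (proj M f psi) + T psi)) +
      ((z *: proj M f psi - T (proj M f psi)) + (T psi - z *: psi)).
      rewrite !scaleN1r -[RHS]addrA; congr (_ + _).
      rewrite scalerDr scalerN !opprD !opprK [RHS]addrACA [_ + (_ - T _)]addrC.
      by rewrite subrK addKr.
    apply: linear_setD => //; first by apply: null_ae_span; exact: T_lin.
    apply: linear_setD => //; apply: linear_setB => //.
      exact: linear_setZ.
    exact: flag_stable flf Sp.
  (* [ae_linear] speaks of combinations [a *: u + v]; homogeneity is its case [v = 0], at the cost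
     of the null vector [T 0]. *)
  have -> : T (s *: r) - z *: (s *: r) =
      (T (s *: r + 0) - (s *: T r + T 0)) + (s *: (T r - z *: r) + T 0).
    rewrite -[RHS]addrA addr0; congr (_ + _).
    by rewrite [s *: (T r - _)]scalerBr addrAC addKr !scalerA mulrC.
  apply: linear_setD => //; first by apply: null_ae_span; exact: T_lin.
  apply: linear_setD => //; first exact: linear_setZ.
  by apply: null_ae_span; exact: (T_null null0).
- move=> i; rewrite ltnS leq_eqVlt /b => /orP[/eqP->|li]; first by rewrite eqxx.
  by rewrite ltn_eqF //; apply: Dd.
- by move=> v /sub /fg.
- rewrite -[psi](subrK (proj M f psi)); apply: linear_setD => //.
  + exact: ae_span_linear.
  + rewrite -[_ - _](_ : s^-1 *: g M = _); last first.
      by rewrite gM scalerA mulVf ?scale1r // gt_eqF.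
    apply: linear_setZ; first exact: ae_span_linear.
    exact: mem_ae_span.
  + exact: fg.
Qed.

Definition gen_eigen z psi := exists n, nullv (iter n (fun u => T u - z *: u) psi).

Lemma flag_extend_seq (D : C -> Prop) (L : seq (C * V)) :
  (forall p, p \in L -> D p.1 /\ gen_eigen p.1 p.2) ->
  exists N e c, [/\ flag N e c, forall i, (i < N)%N -> D (c i) &
    forall p, p \in L -> ae_span N e p.2].
Proof.
elim: L => [_|q L IH hL].
  by exists 0, (fun=> 0), (fun=> 0); split => //; split.
have [p pL|N [e [c [fl Dc sp]]]] := IH.
  by apply: hL; rewrite inE pL orbT.
have [Dq [n qn]] := hL _ (mem_head q L).
have [N' [e' [c' [fl' Dc' sub sq]]]] := flag_extend fl Dc Dq qn.
exists N', e', c'; split => // p; rewrite inE => /orP[/eqP->//|/sp]; exact: sub.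
Qed.

(** * Coordinates along a flag, and the dimension count *)

Definition coords N (e : nat -> V) v : 'rV[C]_N := \row_j ip v (e j).
Definition op_mx N (e : nat -> V) : 'M[C]_N := \matrix_(i, j) ip (T (e i)) (e j).

Lemma coords_lin N e a u v :
  coords N e (a *: u + v) = a *: coords N e u + coords N e v.
Proof. by apply/rowP => j; rewrite !mxE ipP. Qed.

Lemma coords_null N e v : nullv v -> coords N e v = 0.
Proof. by move=> v0; apply/rowP => j; rewrite !mxE null_ipl. Qed.

Lemma coords0_null N e v : ae_span N e v -> coords N e v = 0 -> nullv v.
Proof.
move=> + v0; rewrite /ae_span /resid /proj big1 ?subr0 // => j _.
by move/rowP/(_ j): v0; rewrite !mxE => ->; rewrite scale0r.
Qed.

(** Coordinates turn [T] into an honest matrix, free of exceptional null vectors, so that the theory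
    of kernels of matrix polynomials applies. *)
Lemma coords_op N e v : orthonormal_seq N e -> ae_span N e v ->
  coords N e (T v) = coords N e v *m op_mx N e.
Proof.
move=> eo; apply: (ae_span_min
  (S := fun v => coords N e (T v) = coords N e v *m op_mx N e)).
- split=> [|a u w hu hw].
    by rewrite !coords_null ?mul0mx //; [exact: null0|exact: (T_null null0)].
  have -> : T (a *: u + w) =
      1 *: (T (a *: u + w) - (a *: T u + T w)) + (a *: T u + T w).
    by rewrite scale1r subrK.
  rewrite [LHS]coords_lin.
  rewrite (coords_null _ _ (T_lin _ _ _)) scaler0 add0r !coords_lin hu hw.
  by rewrite mulmxDl -scalemxAl.
- by move=> u u0; rewrite !coords_null ?mul0mx //; exact: T_null.
- move=> j lj; have -> : coords N e (e j) = delta_mx 0 (Ordinal lj).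
    by apply/rowP => i; rewrite !mxE eo //= eq_sym; congr (_%:R).
  by rewrite -rowE; apply/rowP => i; rewrite !mxE.
Qed.

Lemma coords_iter N e c z n v : flag N e c -> ae_span N e v ->
  let F := fun u => T u - z *: u in
  ae_span N e (iter n F v) /\
  coords N e (iter n F v) =
    iter n (fun x : 'rV_N => x *m op_mx N e - z *: x) (coords N e v).
Proof.
move=> fl vS F; elim: n => [//|n [IH1 IH2]] /=; split.
  apply: linear_setB; [exact: ae_span_linear|exact: flag_stable fl IH1|].
  by apply: linear_setZ => //; exact: ae_span_linear.
rewrite -IH2 -(coords_op (proj1 fl) IH1); set w := iter n F v.
by rewrite /F addrC -scaleNr coords_lin addrC scaleNr.
Qed.

Lemma mul_horner_mx_XsubC_exp N (A : 'M[C]_N.+1) z n (x : 'rV_N.+1) :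
  x *m horner_mx A (('X - z%:P) ^+ n) = iter n (fun y => y *m A - z *: y) x.
Proof.
rewrite rmorphXn /= rmorphB /= horner_mx_X horner_mx_C.
elim: n => [|n IH]; first by rewrite expr0 mulmx1.
by rewrite exprSr iterS -IH -mulmxE mulmxA mulmxBr mul_mx_scalar.
Qed.

(** Asserted for all large exponents so that finitely many vectors can share one exponent. *)
Lemma gen_eigen_kermx N e c z psi : flag N e c -> ae_span N e psi ->
  gen_eigen z psi ->
  exists n, forall m, (n <= m)%N ->
   (coords N e psi <= kermxpoly (op_mx N e) (('X - z%:P) ^+ m))%MS.
Proof.
move=> fl sp [n hn]; exists n => m nm.
case: N e fl sp => [|N] e fl sp; first by rewrite thinmx0 sub0mx.
apply/sub_kermxP; rewrite mul_horner_mx_XsubC_exp -(subnK nm) iterD.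
have [_ <-] := coords_iter z n fl sp.
rewrite coords_null //; elim: (m - n)%N => [//|k IH] /=.
by rewrite IH mul0mx scaler0 subr0.
Qed.

(** The kernels of (X - z)^M for distinct z are in direct sum, these polynomials being coprime, and
    the kernel at z contains the coordinates of [mult z] independent vectors. The ranks add up to at
    most [N]. *)
Lemma flag_dim_ge (s : seq C) (mult : C -> nat) (psi : C -> nat -> V) N e c :
  uniq s -> flag N e c ->
  (forall z i, z \in s -> (i < mult z)%N ->
    gen_eigen z (psi z i) /\ ae_span N e (psi z i)) ->
  (forall z, z \in s -> forall a : nat -> C,
    nullv (\sum_(i < mult z) a i *: psi z i) ->
    forall i, (i < mult z)%N -> a i = 0) ->
  (\sum_(z <- s) mult z <= N)%N.
Proof.
move=> us fl hpsi free; have [M hM] : exists M, forall p, p \in [seq (z, i) | z <- s, i <- iota 0 (mult z)] ->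
    (coords N e (psi p.1 p.2) <=
       kermxpoly (op_mx N e) (('X - p.1%:P) ^+ M))%MS.
  apply: (uniform_threshold (P := fun p M => coords N e (psi p.1 p.2) <=
       kermxpoly (op_mx N e) (('X - p.1%:P) ^+ M))%MS) => p.
  case/allpairsPdep => z [i [zs]]; rewrite mem_iota add0n => /= li ->.
  by have [gz sz] := hpsi z i zs li; apply: (gen_eigen_kermx fl).
pose z (l : 'I_(size s)) := s`_l.
have zs l : z l \in s by apply: mem_nth.
pose K (l : 'I_(size s)) := kermxpoly (op_mx N e) (('X - (z l)%:P) ^+ M).
have direct : mxdirect (\sum_l K l)%MS.
  apply: mxdirect_sum_kermx => i j _ _ ji.
  rewrite coprimep_expr ?coprimep_expl// coprimep_XsubC root_XsubC.
  by rewrite nth_uniq // eq_sym.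
rewrite (big_nth 0) big_mkord; apply: (@leq_trans (\sum_l \rank (K l))%N); last first.
  by rewrite -(mxdirectP direct) /= rank_leq_col.
apply: leq_sum => l _; rewrite -/(z l).
pose X := \matrix_(i < mult (z l)) coords N e (psi (z l) i).
(* Independence modulo null vectors becomes independence of rows, since a vector of the span with
   zero coordinates is null. *)
have Xfree : row_free X.
  apply: inj_row_free => v vX.
  pose a i := if insub i is Some j then v 0 j else 0.
  have av (j : 'I__) : a j = v 0 j by rewrite /a insubT // => ?; congr (v 0 _); apply: val_inj.
  apply/rowP => j; rewrite mxE -av; apply: (free (z l)) => //.
  apply: (@coords0_null N e).
    apply: (linear_set_sum (F := fun i => a i *: psi (z l) i)).
      exact: ae_span_linear.
    move=> i li; apply: linear_setZ; first exact: ae_span_linear.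
    by have [] := hpsi (z l) i (zs l) li.
  rewrite -vX; apply/rowP => i; rewrite !mxE ip_suml; apply: eq_bigr => h _.
  by rewrite ipZl av !mxE.
rewrite -[X in (X <= _)%N](eqP Xfree); apply: mxrankS; apply/row_subP => i.
rewrite rowK; apply: (hM (z l, val i)); apply/allpairsPdep.
by exists (z l), (val i); rewrite mem_iota add0n; split => //=.
Qed.

(** [T (e i) - c i *: e i] lies in the span of earlier vectors, orthogonal to [e i], so [c i] is the
    coefficient of [T (e i)] along [e i]; Bessel's inequality is then applied to the single vector
    [e i]. *)
Lemma diag_le_image N e c : flag N e c ->
  \sum_(i < N) `|c i| ^+ 2 <= \sum_(i < N) ip (T (e i)) (T (e i)).
Proof.
move=> [eo tr]; apply: ler_sum => i _.
have ee : ip (e i) (e i) = 1 by rewrite eo // eqxx.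
have ortho1 : orthonormal_seq 1 (fun=> e i).
  by move=> [|//] [|//] _ _; rewrite ee.
have := bessel (T (e i)) ortho1; rewrite big_ord1.
suff -> : ip (T (e i)) (e i) = c i by [].
apply/eqP; rewrite -subr_eq0 -[c i]mulr1 -ee -ipZl -ipBl.
have /eqP := null_ipl (e i) (tr i (ltn_ord i)).
rewrite [ip (resid _ _ _) _]ipBl subr_eq0 => /eqP->; rewrite /proj ip_suml.
rewrite big1 // => j _; rewrite ipZl eo ?(ltn_trans (ltn_ord j)) //.
by rewrite ltn_eqF // mulr0.
Qed.
End SemiInner.

(** * Integral operators on real square-integrable functions *)

Section RealOperator.
Context d (X : measurableType d) (R : realType).
Variable mu : {finite_measure set X -> \bar R}.
Implicit Types (u v : X -> R) (k : X -> X -> R).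

(* 0 where the integral is infinite or undefined. *)
Definition kernel_op k u x : R := \int[mu]_y (u y * k x y).

Definition mkernel k := measurable_fun setT (fun z : X * X => k z.1 z.2).

Lemma mkernel_section k x : mkernel k -> measurable_fun setT (k x).
Proof.
move=> mk; exact: (measurableT_comp mk (pair1_measurable x)).
Qed.

Lemma mkernel_mulr k u : mkernel k -> measurable_fun setT u ->
  mkernel (fun x y => u y * k x y).
Proof.
move=> mk mu_; apply: measurable_funM => //.
by apply: (measurableT_comp mu_); exact: measurable_snd.
Qed.

Lemma mkernel_abs k : mkernel k -> mkernel (fun x y => `|k x y|).
Proof. by move=> mk; apply: measurableT_comp. Qed.

(** Tonelli's theorem for the positive and the negative part separately also covers the points where
    the integral diverges. *)
Lemma measurable_kernel_op k u : mkernel k -> measurable_fun setT u ->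
  measurable_fun setT (kernel_op k u).
Proof.
move=> mk mu_.
have mf : measurable_fun setT (fun z : X * X => (u z.2 * k z.1 z.2)%:E).
  by apply/measurable_EFinP; exact: mkernel_mulr.
pose f z := (u z.2 * k z.1 z.2)%:E.
have -> : kernel_op k u = fine \o (fun x => fubini_F mu f^\+%E x - fubini_F mu f^\-%E x)%E.
  apply/funext => x; rewrite /kernel_op /Rintegral integralE /= /fubini_F.
  by congr (fine (_ - _)%E); apply: eq_integral => y _; rewrite ?funeposE ?funenegE.
apply: measurableT_comp; first exact: fine_measurable.
apply: emeasurable_funB.
  by apply: measurable_fun_fubini_tonelli_F => [|z]; [exact: measurable_funepos|].
by apply: measurable_fun_fubini_tonelli_F => [|z]; [exact: measurable_funeneg|].
Qed.

(** The second factor when Cauchy-Schwarz splits |k| |u| into |k|^(1/2) and |k|^(1/2) |u|, as in the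
    Schur test. *)
Definition near_energy k u x : \bar R := (\int[mu]_y (`|k x y| * u y ^+ 2)%:E)%E.

Lemma integrable_near k u x B : mkernel k -> measurable_fun setT u ->
  (\int[mu]_y `|k x y|%:E <= B%:E)%E -> (near_energy k u x < +oo)%E ->
  mu.-integrable setT (EFin \o (fun y => u y * k x y)).
Proof.
move=> mk mu_ kB Ifin.
have mkx := mkernel_section x mk.
have mk1 : measurable_fun setT (fun y => `|k x y|%:E).
  by apply/measurable_EFinP; exact: measurableT_comp.
have mk2 : measurable_fun setT (fun y => (`|k x y| * u y ^+ 2)%:E).
  apply/measurable_EFinP; apply: measurable_funM; first exact: measurableT_comp.
  exact: measurable_funX.
have mg : measurable_fun setT (fun y => (u y * k x y)%:E).
  by apply/measurable_EFinP; apply: measurable_funM.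
apply/integrableP; split; first exact: mg.
apply: (@le_lt_trans _ _ (\int[mu]_y (`|k x y|%:E + (`|k x y| * u y ^+ 2)%:E))%E).
  apply: ge0_le_integral => //=.
  - by apply/measurable_EFinP; apply: measurableT_comp => //; apply/measurable_EFinP.
  - exact: emeasurable_funD.
  - move=> y _; rewrite -EFinD lee_fin normrM mulrC -[X in _ <= X + _]mulr1 -mulrDr.
    apply: ler_wpM2l => //;
    have := sqr_ge0 (`|u y| - 1); rewrite -[u y ^+ 2]real_normK ?num_real //; nra.
rewrite ge0_integralD //=; last by move=> y _; rewrite lee_fin mulr_ge0 // sqr_ge0.
apply: lte_add_pinfty => //; apply: le_lt_trans kB _; exact: ltry.
Qed.

(** Cauchy-Schwarz for the weight |k(x, .)|, obtained from |u| <= t/2 + u^2/(2t): integration gives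
    |K u| <= (t B + I/t)/2 for every t > 0, where I is the energy. If I is infinite, so is the
    right-hand side. *)
Lemma kernel_op_sqr_le k u x B : mkernel k -> measurable_fun setT u ->
  0 < B -> (\int[mu]_y `|k x y|%:E <= B%:E)%E ->
  ((kernel_op k u x ^+ 2)%:E <= B%:E * near_energy k u x)%E.
Proof.
move=> mk mu_ B0 kB.
have [Ifin|] := ltP (near_energy k u x) +oo%E; last first.
  by rewrite leye_eq => /eqP->; rewrite gt0_muley ?leey.
have int1 := integrable_near mk mu_ kB Ifin.
have I0 : (0 <= near_energy k u x)%E.
  by apply: integral_ge0 => y _; rewrite lee_fin mulr_ge0 // sqr_ge0.
have [I EI] : exists I, near_energy k u x = I%:E.
  by exists (fine (near_energy k u x)); rewrite fineK // ge0_fin_numE.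
rewrite EI -EFinM lee_fin; rewrite EI lee_fin in I0.
have mkx := mkernel_section x mk.
have mk1 : measurable_fun setT (fun y => `|k x y|%:E).
  by apply/measurable_EFinP; exact: measurableT_comp.
have mk2 : measurable_fun setT (fun y => (`|k x y| * u y ^+ 2)%:E).
  apply/measurable_EFinP; apply: measurable_funM; first exact: measurableT_comp.
  exact: measurable_funX.
have mg : measurable_fun setT (fun y => (u y * k x y)%:E).
  by apply/measurable_EFinP; apply: measurable_funM.
have key t : 0 < t -> `|kernel_op k u x| <= (t * B + I / t) / 2.
  move=> t0; rewrite -lee_fin EFin_normr_Rintegral //.
  apply: le_trans (le_abse_integral _ _ mg) _ => //.
  apply: (@le_trans _ _ (\int[mu]_y ((t / 2)%:E * `|k x y|%:E +
     (t^-1 / 2)%:E * (`|k x y| * u y ^+ 2)%:E))%E).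
    apply: ge0_le_integral => //=.
    - by apply/measurable_EFinP; apply: measurableT_comp => //; apply/measurable_EFinP.
    - by apply: emeasurable_funD; exact: measurable_funeM.
    - move=> y _; rewrite -!EFinM -EFinD lee_fin normrM.
      rewrite -[u y ^+ 2]real_normK ?num_real //.
      have := sqr_ge0 (`|u y| - t); set a := `|u y|; set b := `|k x y| => h.
      have -> : t / 2 * b + t^-1 / 2 * (b * a ^+ 2) = a * b + b * (a - t) ^+ 2 / (2 * t).
        by field; rewrite gt_eqF.
      by rewrite lerDl; apply: divr_ge0; apply: mulr_ge0 => //; [exact: normr_ge0|exact: ltW].
  rewrite ge0_integralD //=.
  - rewrite ge0_integralZl_EFin //=; last by rewrite divr_ge0 // ltW.
    rewrite ge0_integralZl_EFin //=.
    + rewrite -/(near_energy k u x) EI.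
      rewrite -EFinM; apply: (@le_trans _ _ ((t / 2)%:E * B%:E + (t^-1 / 2 * I)%:E)%E).
        by rewrite leeD2r // lee_pmul2l // lte_fin divr_gt0.
      by rewrite -EFinM -EFinD lee_fin; lra.
    + by move=> y _; rewrite lee_fin mulr_ge0 // sqr_ge0.
    + by rewrite divr_ge0 // invr_ge0 ltW.
  - by move=> y _; rewrite -EFinM lee_fin; apply: mulr_ge0 => //; rewrite divr_ge0 // ltW.
  - exact: measurable_funeM.
  - move=> y _; rewrite -EFinM lee_fin; apply: mulr_ge0; last by rewrite mulr_ge0 // sqr_ge0.
    by rewrite divr_ge0 // invr_ge0 ltW.
  - exact: measurable_funeM.
rewrite -real_normK ?num_real //; set w := `|kernel_op k u x| in key *.
have [->|w0] := eqVneq w 0; first by rewrite expr0n /= mulr_ge0 // ltW.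
have {}w0 : 0 < w by rewrite lt_neqAle eq_sym w0 normr_ge0.
(* Taking t = w/B instead of the minimizer sqrt(I/B) needs no square root and covers I = 0; the
   bound becomes w <= (w + I B/w)/2. *)
have := key (w / B) (divr_gt0 w0 B0).
have -> : (w / B * B + I / (w / B)) / 2 = (w + I * B / w) / 2.
  by field; rewrite !gt_eqF.
move=> h; have : w <= I * B / w by lra.
by rewrite ler_pdivlMr // -expr2 mulrC.
Qed.

Lemma measurable_near_energy k u : mkernel k -> measurable_fun setT u ->
  measurable_fun setT (near_energy k u).
Proof.
move=> mk mu_; pose f (z : X * X) := (`|k z.1 z.2| * u z.2 ^+ 2)%:E.
have mf : measurable_fun setT f.
  apply/measurable_EFinP; apply: measurable_funM; first exact: mkernel_abs.
  by apply: measurable_funX; apply: (measurableT_comp mu_); exact: measurable_snd.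
apply: (@measurable_fun_fubini_tonelli_F _ _ _ _ _ mu f) => // z.
by rewrite lee_fin mulr_ge0 // sqr_ge0.
Qed.

Lemma near_energy_ge0 k u x : (0 <= near_energy k u x)%E.
Proof. by apply: integral_ge0 => y _; rewrite lee_fin mulr_ge0 // sqr_ge0. Qed.

Lemma near_energy_integral k u B : mkernel k -> measurable_fun setT u ->
  (forall y, (\int[mu]_x `|k x y|%:E <= B%:E)%E) ->
  (\int[mu]_x near_energy k u x <= B%:E * \int[mu]_y (u y ^+ 2)%:E)%E.
Proof.
move=> mk mu_ kB; pose f (z : X * X) := (`|k z.1 z.2| * u z.2 ^+ 2)%:E.
have mf : measurable_fun setT f.
  apply/measurable_EFinP; apply: measurable_funM; first exact: mkernel_abs.
  by apply: measurable_funX; apply: (measurableT_comp mu_); exact: measurable_snd.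
have f0 z : (0 <= f z)%E by rewrite lee_fin mulr_ge0 // sqr_ge0.
have mu2 : measurable_fun setT (fun y => (u y ^+ 2)%:E).
  by apply/measurable_EFinP; exact: measurable_funX.
have B0 : 0 <= B by rewrite -lee_fin; apply: le_trans (kB point); apply: integral_ge0.
rewrite (@fubini_tonelli _ _ _ _ _ mu mu f mf f0).
rewrite -ge0_integralZl_EFin //=; last by move=> y _; rewrite lee_fin sqr_ge0.
apply: ge0_le_integral => //=.
- by move=> y _; apply: integral_ge0 => x _; exact: f0.
- exact: (@measurable_fun_fubini_tonelli_G _ _ _ _ _ mu f).
- exact: measurable_funeM.
- move=> y _.
  under eq_integral do rewrite /f /= mulrC EFinM.
  rewrite ge0_integralZl_EFin //= ?sqr_ge0 //; last first.
    apply/measurable_EFinP; apply: measurableT_comp => //.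
    exact: (measurableT_comp mk (pair2_measurable y)).
  by rewrite muleC lee_wpmul2r // lee_fin sqr_ge0.
Qed.

Lemma Lfun2P u : reflect (measurable_fun setT u /\ (\int[mu]_y (u y ^+ 2)%:E < +oo)%E)
  (u \in Lfun mu 2%:E).
Proof.
apply: (iffP idP) => [u2|[mu_ u2]].
  split; first by move/sub_Lfun_mfun: u2; rewrite inE.
  have /integrableP[_] := Lfun2_integrable_sqr u2.
  by under eq_integral do rewrite gee0_abs ?lee_fin ?sqr_ge0 //.
rewrite inE; apply/andP; split; rewrite inE //= /finite_norm unlock /Lnorm.
rewrite poweR_lty //; apply: le_lt_trans u2.
under eq_integral => y _ do (rewrite /= powR_mulrn ?normr_ge0 // real_normK ?num_real //).
exact: lexx.
Qed.

Definition schur k B := [/\ mkernel k,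
  forall x, (\int[mu]_y `|k x y|%:E <= B%:E)%E &
  forall y, (\int[mu]_x `|k x y|%:E <= B%:E)%E].

(** The Schur test: one factor [B] comes from the rows by Cauchy-Schwarz, the other from the columns
    by Tonelli. *)
Lemma kernel_op_energy k u B : 0 < B -> schur k B -> measurable_fun setT u ->
  (\int[mu]_x (kernel_op k u x ^+ 2)%:E <= (B ^+ 2)%:E * \int[mu]_y (u y ^+ 2)%:E)%E.
Proof.
move=> B0 [mk k1 k2] mu_.
apply: (@le_trans _ _ (\int[mu]_x (B%:E * near_energy k u x))%E).
  apply: ge0_le_integral => //=.
  - by move=> x _; rewrite lee_fin sqr_ge0.
  - by apply/measurable_EFinP; apply: measurable_funX; exact: measurable_kernel_op.
  - by apply: measurable_funeM; exact: measurable_near_energy.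
  - by move=> x _; apply: kernel_op_sqr_le.
rewrite ge0_integralZl_EFin //; first last.
- exact: ltW.
- exact: measurable_near_energy.
- by move=> x _; exact: near_energy_ge0.
rewrite expr2 EFinM -muleA lee_wpmul2l ?lee_fin ?(ltW B0) //.
exact: near_energy_integral.
Qed.

Lemma kernel_op_Lfun2 k u B : 0 < B -> schur k B -> u \in Lfun mu 2%:E ->
  kernel_op k u \in Lfun mu 2%:E.
Proof.
move=> B0 kB /Lfun2P[mu_ u2]; have [mk _ _] := kB; apply/Lfun2P; split.
  exact: measurable_kernel_op.
apply: le_lt_trans (kernel_op_energy B0 kB mu_) _.
rewrite lte_mul_pinfty // ?lee_fin ?sqr_ge0 //.
Qed.

(** The energy has a finite integral, hence is finite almost everywhere. At such points [kernel_op]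
    is a convergent integral and therefore additive in [u]. *)
Lemma ae_integrable_kernel_op k u B : 0 < B -> schur k B -> u \in Lfun mu 2%:E ->
  {ae mu, forall x, mu.-integrable setT (EFin \o (fun y => u y * k x y))}.
Proof.
move=> B0 [mk k1 k2] /Lfun2P[mu_ u2].
have : mu.-integrable setT (near_energy k u).
  apply/integrableP; split; first exact: measurable_near_energy.
  under eq_integral do rewrite gee0_abs ?near_energy_ge0 //.
  apply: le_lt_trans (near_energy_integral mk mu_ k2) _.
  by rewrite lte_mul_pinfty // lee_fin ltW.
move/(integrable_ae measurableT); apply: filterS => x /(_ Logic.I) nx.
by apply: (integrable_near mk mu_ (k1 x)); rewrite -ge0_fin_numE // near_energy_ge0.
Qed.

(** (a + b)^2 <= 2 a^2 + 2 b^2. Where the near energy is infinite the right-hand side is infinite,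
    so default values of the integral cause no exception. *)
Lemma kernel_op_far_near_le kf kn u x B : mkernel kf -> mkernel kn -> 0 < B ->
  measurable_fun setT u -> (\int[mu]_y `|kn x y|%:E <= B%:E)%E ->
  mu.-integrable setT (EFin \o (fun y => u y * kf x y)) ->
  ((kernel_op (fun x y => kf x y + kn x y) u x ^+ 2)%:E <=
    (2 * kernel_op kf u x ^+ 2)%:E + (2 * B)%:E * near_energy kn u x)%E.
Proof.
move=> mkf mkn B0 mu_ knB intf.
have [Ifin|] := ltP (near_energy kn u x) +oo%E; last first.
  by rewrite leye_eq => /eqP->; rewrite gt0_muley ?lte_fin ?mulr_gt0 // addey ?leey.
have intn := integrable_near mkn mu_ knB Ifin.
have -> : kernel_op (fun x y => kf x y + kn x y) u x = kernel_op kf u x + kernel_op kn u x.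
  rewrite /kernel_op -RintegralD //.
  by apply: eq_Rintegral => y _; rewrite mulrDr.
apply: (@le_trans _ _ (2 * kernel_op kf u x ^+ 2 + 2 * kernel_op kn u x ^+ 2)%:E).
  rewrite lee_fin; have := sqr_ge0 (kernel_op kf u x - kernel_op kn u x); nra.
rewrite EFinD leeD2l // !EFinM -muleA lee_pmul2l // ?lte_fin //.
exact: kernel_op_sqr_le.
Qed.
End RealOperator.

(** * The complex space of square-integrable functions *)

Local Notation Rep f := (fun x => complex.Re (f x)).
Local Notation Imp f := (fun x => complex.Im (f x)).

Section L2Space.
Context d (X : measurableType d) (R : realType).
Variable mu : {measure set X -> \bar R}.

Definition L2_pred : {pred X -> R[i]^o} := fun f => `[< L2 mu f >].

Lemma lee12 : (1 <= 2%:E :> \bar R)%E.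
Proof. by rewrite lee1n. Qed.

Lemma Lfun2_lin (a b : R) (u v : X -> R) :
  u \in Lfun mu 2%:E -> v \in Lfun mu 2%:E ->
  (fun x => a * u x + b * v x) \in Lfun mu 2%:E.
Proof.
move=> hu hv; have [_ h] := Lfun_submod_closed mu lee12.
have -> : (fun x => a * u x + b * v x) = a *: (u : X -> R^o) + b *: (v : X -> R^o) by [].
apply: (h a u (b *: (v : X -> R^o))) => //.
rewrite -[b *: _]addr0; apply: (h b v 0) => //.
by case: (Lfun_submod_closed mu lee12).
Qed.

Lemma L2_lin (a : R[i]) (f g : X -> R[i]) : L2 mu f -> L2 mu g ->
  L2 mu (fun x => a * f x + g x).
Proof.
move=> [f1 f2] [g1 g2]; case: a => a1 a2.
split.
  rewrite (_ : (fun x => _) = fun x =>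
    1 * (a1 * complex.Re (f x) + (- a2) * complex.Im (f x)) + 1 * complex.Re (g x)).
    by apply: Lfun2_lin => //; apply: Lfun2_lin.
  by apply/funext => x; case: (f x) (g x) => [? ?] [? ?] /=; rewrite !mul1r mulNr.
rewrite (_ : (fun x => _) = fun x =>
    1 * (a1 * complex.Im (f x) + a2 * complex.Re (f x)) + 1 * complex.Im (g x)).
  by apply: Lfun2_lin => //; apply: Lfun2_lin.
by apply/funext => x; case: (f x) (g x) => [? ?] [? ?] /=; rewrite !mul1r.
Qed.

Lemma L2_0 : L2 mu (fun=> 0).
Proof.
by split => /=; case: (Lfun_submod_closed mu lee12).
Qed.

Lemma L2_submod_closed : submod_closed L2_pred.
Proof.
split; first by apply/asboolP; exact: L2_0.
by move=> a f g /asboolP hf /asboolP hg; apply/asboolP; exact: L2_lin.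
Qed.

HB.instance Definition _ := GRing.isSubmodClosed.Build _ _ L2_pred L2_submod_closed.

(** Functions and not classes, because the operator acts on functions; equality almost everywhere
    reappears as nullity for [L2ip]. *)
Record L2fun := MkL2fun { L2val :> X -> R[i]^o; L2valP : L2_pred L2val }.
HB.instance Definition _ := [isSub for L2val].
HB.instance Definition _ := [Choice of L2fun by <:].
HB.instance Definition _ := [SubChoice_isSubLmodule of L2fun by <:].

Lemma L2funP (f : L2fun) : L2 mu f.
Proof. by case: f => f /= /asboolP. Qed.

Definition ipR (u v : X -> R) : R := \int[mu]_x (u x * v x).

Lemma integrable_mul (u v : X -> R) : u \in Lfun mu 2%:E -> v \in Lfun mu 2%:E ->
  mu.-integrable setT (EFin \o (fun x => u x * v x)).
Proof. by move=> hu hv; apply/Lfun1_integrable; exact: Lfun2_mul_Lfun1. Qed.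

Lemma ipRC (u v : X -> R) : ipR u v = ipR v u.
Proof. by apply: eq_Rintegral => x _; rewrite mulrC. Qed.

Lemma ipR_lin (a b : R) (u v w : X -> R) : u \in Lfun mu 2%:E ->
  v \in Lfun mu 2%:E -> w \in Lfun mu 2%:E ->
  ipR (fun x => a * u x + b * v x) w = a * ipR u w + b * ipR v w.
Proof.
move=> hu hv hw; have iu := integrable_mul hu hw; have iv := integrable_mul hv hw.
rewrite /ipR -RintegralZl // -RintegralZl // -RintegralD //; first last.
- exact: (integrableZl measurableT b iv).
- exact: (integrableZl measurableT a iu).
by apply: eq_Rintegral => x _; rewrite mulrDl !mulrA.
Qed.

Lemma ipR_sqr (u : X -> R) : u \in Lfun mu 2%:E ->
  (ipR u u)%:E = (\int[mu]_x (u x ^+ 2)%:E)%E.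
Proof.
move=> hu; rewrite /ipR /Rintegral fineK.
  by apply: eq_integral => x _; rewrite expr2.
exact: (integrable_fin_num measurableT (integrable_mul hu hu)).
Qed.

Lemma ipR_ge0 (u : X -> R) : 0 <= ipR u u.
Proof. by apply: Rintegral_ge0 => x _; rewrite -expr2 sqr_ge0. Qed.

(** The integral of [f] times the conjugate of [g], in real and imaginary parts. *)
Definition L2ip (f g : L2fun) : R[i] :=
  (ipR (Rep f) (Rep g) + ipR (Imp f) (Imp g)) +i*
  (ipR (Imp f) (Rep g) - ipR (Rep f) (Imp g)).

Lemma L2val_lin (a : R[i]) (f g : L2fun) x :
  (a *: f + g : L2fun) x = a * f x + g x.
Proof. by []. Qed.

(** The factors 1 give the right-hand side the shape of a nested two-term combination, to which
    [Lfun2_lin] and [ipR_lin] apply twice. *)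
Lemma Rep_lin (a : R[i]) (f g : L2fun) : Rep (a *: f + g : L2fun) = fun x =>
  1 * (complex.Re a * complex.Re (f x) + (- complex.Im a) * complex.Im (f x))
  + 1 * complex.Re (g x).
Proof.
apply/funext => x; rewrite !mul1r L2val_lin; case: a => a1 a2 /=.
by case: (f x) (g x) => [? ?] [? ?] /=; rewrite mulNr.
Qed.

Lemma Imp_lin (a : R[i]) (f g : L2fun) : Imp (a *: f + g : L2fun) = fun x =>
  1 * (complex.Re a * complex.Im (f x) + complex.Im a * complex.Re (f x))
  + 1 * complex.Im (g x).
Proof.
apply/funext => x; rewrite !mul1r L2val_lin; case: a => a1 a2 /=.
by case: (f x) (g x) => [? ?] [? ?] /=.
Qed.

Lemma L2ip_semi_inner : semi_inner L2ip.
Proof.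
split=> [a f g h|f g|f].
- have [f1 f2] := L2funP f; have [g1 g2] := L2funP g; have [h1 h2] := L2funP h.
  rewrite /L2ip Rep_lin Imp_lin !ipR_lin ?Lfun2_lin // !mul1r.
  by case: a => a1 a2 /=; apply/eqP; rewrite eq_complex /=; apply/andP; split; apply/eqP; ring.
- rewrite /L2ip; apply/eqP; rewrite eq_complex /= !(ipRC (Rep g)) !(ipRC (Imp g)).
  by apply/andP; split; apply/eqP; ring.
- by rewrite lecE /L2ip /= (ipRC (Imp f)) subrr eqxx addr_ge0 ?ipR_ge0.
Qed.

Lemma L2ip_sqr (f : L2fun) : L2ip f f = (ipR (Rep f) (Rep f) + ipR (Imp f) (Imp f))%:C.
Proof. by rewrite /L2ip (ipRC (Imp f)) subrr. Qed.

Lemma ipR_eq0 (u : X -> R) : u \in Lfun mu 2%:E ->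
  (ipR u u = 0 <-> {ae mu, forall x, u x = 0}).
Proof.
move=> hu; have iu := integrable_mul hu hu.
have mu2 := measurable_int _ iu.
have E : (ipR u u)%:E = (\int[mu]_x `|(u x * u x)%:E|)%E.
  rewrite ipR_sqr //; apply: eq_integral => x _.
  by rewrite gee0_abs // lee_fin -expr2 sqr_ge0.
have ab := ae_eq_integral_abs mu measurableT mu2.
split=> [u0|u0].
  have : (\int[mu]_x `|(u x * u x)%:E| = 0)%E by rewrite -E u0.
  move/ab; apply: filterS => x /(_ Logic.I) [] /eqP.
  by rewrite mulf_eq0 orbb => /eqP.
apply/EFin_inj; rewrite E; apply/ab; apply: filterS u0 => x ux _ /=.
by rewrite ux mul0r.
Qed.

Lemma nullv_ae (f : L2fun) : nullv L2ip f <-> {ae mu, forall x, f x = 0}.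
Proof.
have [f1 f2] := L2funP f; rewrite /nullv L2ip_sqr; split.
  move=> [] /eqP; rewrite paddr_eq0 ?ipR_ge0 // => /andP[/eqP + /eqP].
  move/(ipR_eq0 f1) => + /(ipR_eq0 f2); apply: filterS2 => x.
  by case: (L2val f x) => a b /= -> ->.
move=> f0; have -> : ipR (Rep f) (Rep f) = 0.
  by apply/ipR_eq0 => //; apply: filterS f0 => x ->.
have -> : ipR (Imp f) (Imp f) = 0; last by rewrite addr0.
by apply/ipR_eq0 => //; apply: filterS f0 => x ->.
Qed.

End L2Space.

(** * Hilbert-Schmidt and Schur bounds *)

Section KernelOperator.
Context d (X : measurableType d) (R : realType).
Variable mu : {finite_measure set X -> \bar R}.
Variables (k : X -> X -> R) (B : R).
Hypotheses (B0 : 0 < B) (kB : schur mu k B).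

Definition ckernel_op (f : X -> R[i]) (x : X) : R[i] :=
  kernel_op mu k (Rep f) x +i* kernel_op mu k (Imp f) x.

Lemma ckernel_op_L2 (f : X -> R[i]) : L2 mu f -> L2 mu (ckernel_op f).
Proof. by move=> [f1 f2]; split => /=; exact: kernel_op_Lfun2 kB _. Qed.

Lemma L2op_subproof (f : L2fun mu) : L2_pred mu (ckernel_op f).
Proof. by apply/asboolP/ckernel_op_L2/L2funP. Qed.

Definition L2op (f : L2fun mu) : L2fun mu := MkL2fun (L2op_subproof f).

(** Null functions stay null because the Schur test bounds the image by B^2 times a zero norm.
    Linearity holds at each point where the integrals of the real and imaginary parts of [f] and [g]
    all converge, hence almost everywhere. *)
Lemma L2op_ae_linear : ae_linear (@L2ip _ _ _ mu) L2op.
Proof.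
split=> [f /nullv_ae f0|a f g]; apply/nullv_ae.
  have [f1 f2] := L2funP f.
  have z (u : X -> R) : u \in Lfun mu 2%:E -> {ae mu, forall x, u x = 0} ->
      {ae mu, forall x, kernel_op mu k u x = 0}.
    move=> hu u0; apply/(ipR_eq0 (kernel_op_Lfun2 B0 kB hu)).
    apply/eqP; rewrite eq_le ipR_ge0 andbT -lee_fin ipR_sqr ?(kernel_op_Lfun2 B0 kB hu) //.
    have /Lfun2P[mu_ _] := hu.
    apply: le_trans (kernel_op_energy B0 kB mu_) _.
    by rewrite -ipR_sqr // (proj2 (ipR_eq0 hu) u0) mule0.
  have h1 : {ae mu, forall x, kernel_op mu k (Rep f) x = 0}.
    by apply: z => //; apply: filterS f0 => x ->.
  have h2 : {ae mu, forall x, kernel_op mu k (Imp f) x = 0}.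
    by apply: z => //; apply: filterS f0 => x ->.
  by apply: filterS2 h1 h2 => x; rewrite /= /ckernel_op => -> ->.
have [f1 f2] := L2funP f; have [g1 g2] := L2funP g.
have F1 := ae_integrable_kernel_op B0 kB f1; have F2 := ae_integrable_kernel_op B0 kB f2.
have G1 := ae_integrable_kernel_op B0 kB g1; have G2 := ae_integrable_kernel_op B0 kB g2.
pose I u x := mu.-integrable setT (EFin \o (fun y => u y * k x y)).
have F12 : {ae mu, forall x, I (Rep f) x /\ I (Imp f) x}.
  by apply: filterS2 F1 F2 => x.
apply: filterS3 F12 G1 G2 => x [i1 i2] j1 j2.
have lin (u v w : X -> R) (b c : R) :
    mu.-integrable setT (EFin \o (fun y => u y * k x y)) ->
    mu.-integrable setT (EFin \o (fun y => v y * k x y)) ->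
    mu.-integrable setT (EFin \o (fun y => w y * k x y)) ->
    kernel_op mu k (fun y => 1 * (b * u y + c * v y) + 1 * w y) x =
    b * kernel_op mu k u x + c * kernel_op mu k v x + kernel_op mu k w x.
  move=> iu iv iw; rewrite /kernel_op -RintegralZl // -RintegralZl //.
  have ibu := integrableZl measurableT b iu.
  have icv := integrableZl measurableT c iv.
  rewrite -RintegralD // -RintegralD //; last exact: (integrableD measurableT ibu icv).
  by apply: eq_Rintegral => y _; ring.
rewrite -[L2op _ - _]addrC -scaleN1r L2val_lin L2val_lin /= /ckernel_op Rep_lin Imp_lin.
rewrite !lin //; case: a => a1 a2.
by apply/eqP; rewrite eq_complex /=; apply/andP; split; apply/eqP; ring.
Qed.

Lemma L2op_iter z (f : L2fun mu) n :
  L2val (iter n (fun u => L2op u - z *: u) f) =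
  iter n (fun phi x => ckernel_op phi x - z * phi x) f.
Proof. by elim: n => [//|n IH] /=; rewrite -IH. Qed.

Lemma gen_eigenE z (f : L2fun mu) : gen_eigen (@L2ip _ _ _ mu) L2op z f <->
  exists n, {ae mu, forall x, iter n (fun phi x => ckernel_op phi x - z * phi x) f x = 0}.
Proof.
split=> -[n h]; exists n; first by rewrite -L2op_iter; apply/nullv_ae.
by apply/nullv_ae; rewrite L2op_iter.
Qed.

(** The section kf(x, .) is real, so its inner product with [e i] is the conjugate of the value at
    [x] of the image of [e i]; both have the same modulus. *)
Lemma bessel_section (kf : X -> X -> R) N (e : nat -> L2fun mu) x :
  orthonormal_seq (@L2ip _ _ _ mu) N e -> kf x \in Lfun mu 2%:E ->
  ((\sum_(i < N) (kernel_op mu kf (Rep (e i)) x ^+ 2 + kernel_op mu kf (Imp (e i)) x ^+ 2))%:E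
   <= \int[mu]_y (kf x y ^+ 2)%:E)%E.
Proof.
move=> eo kfx.
have fL2 : L2_pred mu (fun y => (kf x y)%:C : R[i]^o).
  apply/asboolP; split => //=.
  by case: (Lfun_submod_closed mu (lee12 R)).
pose f := MkL2fun fL2.
have := bessel (L2ip_semi_inner mu) f eo.
have zl (u : X -> R) : ipR mu (Imp f) u = 0.
  by rewrite /ipR /=; under eq_Rintegral do rewrite mul0r; rewrite /Rintegral integral0.
rewrite L2ip_sqr zl addr0 -ipR_sqr // lee_fin.
rewrite (_ : \sum_(i < N) _ = (\sum_(i < N)
  (kernel_op mu kf (Rep (e i)) x ^+ 2 + kernel_op mu kf (Imp (e i)) x ^+ 2))%:C).
  by rewrite lecR.
rewrite rmorph_sum /=; apply: eq_bigr => i _.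
have E u : ipR mu (Rep f) u = kernel_op mu kf u x.
  by apply: eq_Rintegral => y _; rewrite mulrC.
rewrite normCK /L2ip !zl !E; apply/eqP; rewrite eq_complex /=.
by apply/andP; split; apply/eqP; ring.
Qed.

End KernelOperator.

Section TraceBound.
Context d (X : measurableType d) (R : realType).
Variable mu : {finite_measure set X -> \bar R}.
Variables (kf kn : X -> X -> R) (A b : R).
Hypotheses (mkf : mkernel kf) (b0 : 0 < b) (knb : schur mu kn b).
Hypothesis kfA : forall x, (\int[mu]_y (kf x y ^+ 2)%:E <= A%:E)%E.

Let k x y := kf x y + kn x y.

Lemma far_section_L2 x : kf x \in Lfun mu 2%:E.
Proof.
apply/Lfun2P; split; first exact: mkernel_section.
exact: le_lt_trans (kfA x) (ltry _).
Qed.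

Lemma kernel_op_energy_split (u : X -> R) : u \in Lfun mu 2%:E ->
  (\int[mu]_x (kernel_op mu k u x ^+ 2)%:E <=
   2%:E * \int[mu]_x (kernel_op mu kf u x ^+ 2)%:E + (2 * b ^+ 2 * ipR mu u u)%:E)%E.
Proof.
move=> hu; have /Lfun2P[mu_ _] := hu; have [mkn kn1 kn2] := knb.
have mk : mkernel k by exact: measurable_funD.
have m1 : measurable_fun setT (fun x => (kernel_op mu kf u x ^+ 2)%:E).
  by apply/measurable_EFinP; apply: measurable_funX; exact: measurable_kernel_op.
have m2 := measurable_near_energy mu mkn mu_.
apply: (@le_trans _ _ (\int[mu]_x (2%:E * (kernel_op mu kf u x ^+ 2)%:E +
    (2 * b)%:E * near_energy mu kn u x))%E).
  apply: ge0_le_integral => //=.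
  - by move=> x _; rewrite lee_fin sqr_ge0.
  - by apply/measurable_EFinP; apply: measurable_funX; exact: measurable_kernel_op.
  - by apply: emeasurable_funD; exact: measurable_funeM.
  - move=> x _; rewrite -EFinM; apply: kernel_op_far_near_le => //.
    have := integrable_mul (far_section_L2 x) hu.
    by apply: eq_integrable => // y _ /=; rewrite mulrC.
rewrite ge0_integralD //=; first last.
- exact: measurable_funeM.
- by move=> x _; rewrite mule_ge0 ?near_energy_ge0 // lee_fin mulr_ge0 // ltW.
- exact: measurable_funeM.
- by move=> x _; rewrite -EFinM lee_fin mulr_ge0 // sqr_ge0.
rewrite ge0_integralZl_EFin //=; last by move=> x _; rewrite lee_fin sqr_ge0.
rewrite ge0_integralZl_EFin //=; first last.
- by rewrite mulr_ge0 // ltW.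
- by move=> x _; exact: near_energy_ge0.
rewrite leeD2l // (_ : 2 * b ^+ 2 * _ = (2 * b) * (b * ipR mu u u)); last by ring.
rewrite [leRHS]EFinM lee_wpmul2l ?lee_fin ?mulr_ge0 // ?(ltW b0) //.
rewrite EFinM ipR_sqr //. exact: (near_energy_integral mkn mu_ kn2).
Qed.

(** The sum over [i] is moved inside the integral in x, so that Bessel's inequality bounds the far
    part by [A] at each point, whatever [N] is. The near part costs 2 b^2 for each unit vector. Both
    factors 2 come from splitting the square. *)
Lemma trace_image_le B (B0 : 0 < B) (kB : schur mu k B) N (e : nat -> L2fun mu) :
  orthonormal_seq (@L2ip _ _ _ mu) N e ->
  \sum_(i < N) L2ip (L2op B0 kB (e i)) (L2op B0 kB (e i)) <=
  (2 * A * fine (mu setT) + 2 * b ^+ 2 * N%:R)%:C.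
Proof.
move=> eo.
have hR i : Rep (e i) \in Lfun mu 2%:E by have [] := L2funP (e i).
have hI i : Imp (e i) \in Lfun mu 2%:E by have [] := L2funP (e i).
pose F i x := kernel_op mu kf (Rep (e i)) x ^+ 2 + kernel_op mu kf (Imp (e i)) x ^+ 2.
have mT u : u \in Lfun mu 2%:E -> measurable_fun setT (fun x => (kernel_op mu kf u x ^+ 2)%:E).
  move=> /Lfun2P[mu_ _].
  by apply/measurable_EFinP; apply: measurable_funX; exact: measurable_kernel_op.
have mF i : measurable_fun setT (fun x => (F i x)%:E).
  by rewrite /F; under eq_fun do rewrite EFinD; apply: emeasurable_funD; exact: mT.
have F0 i x : (0 <= (F i x)%:E)%E by rewrite lee_fin addr_ge0 // sqr_ge0.
pose E i := ipR mu (kernel_op mu k (Rep (e i))) (kernel_op mu k (Rep (e i))) +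
            ipR mu (kernel_op mu k (Imp (e i))) (kernel_op mu k (Imp (e i))).
have step i : (i < N)%N -> ((E i)%:E <= 2%:E * \int[mu]_x (F i x)%:E + (2 * b ^+ 2)%:E)%E.
  move=> iN; rewrite EFinD !ipR_sqr ?(kernel_op_Lfun2 B0 kB) //.
  apply: (le_trans (leeD (kernel_op_energy_split (hR i)) (kernel_op_energy_split (hI i)))).
  rewrite addeACA -EFinD -mulrDr.
  have -> : ipR mu (Rep (e i)) (Rep (e i)) + ipR mu (Imp (e i)) (Imp (e i)) = 1.
    by have := eo i i iN iN; rewrite L2ip_sqr eqxx => -[].
  rewrite mulr1 leeD2r // -ge0_muleDr; try by apply: integral_ge0 => x _; rewrite lee_fin sqr_ge0.
  rewrite lee_pmul2l // ?lte_fin // -ge0_integralD //=.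
  - by move=> x _; rewrite lee_fin sqr_ge0.
  - exact: mT.
  - by move=> x _; rewrite lee_fin sqr_ge0.
  - exact: mT.
have muT : (fine (mu setT))%:E = mu setT by rewrite fineK // fin_num_measure.
rewrite (_ : \sum_(i < N) _ = (\sum_(i < N) E i)%:C); last first.
  by rewrite rmorph_sum /=; apply: eq_bigr => i _; rewrite L2ip_sqr.
rewrite lecR -lee_fin -sumEFin.
apply: (@le_trans _ _ (\sum_(i < N) (2%:E * \int[mu]_x (F i x)%:E + (2 * b ^+ 2)%:E))%E).
  by apply: lee_sum => i _; exact: step.
rewrite big_split /= [leRHS]EFinD; apply: leeD; last first.
  by rewrite sumEFin lee_fin sumr_const card_ord mulr_natr.
rewrite -ge0_sume_distrr; last by move=> i _; apply: integral_ge0 => x _; exact: F0.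
rewrite -mulrA EFinM lee_pmul2l // ?lte_fin //.
rewrite -ge0_integral_sum //=.
rewrite [leRHS]EFinM muT -integral_cst //; apply: ge0_le_integral => //=.
- by move=> x _; apply: sume_ge0 => i _; exact: F0.
- by apply: emeasurable_sum.
- move=> x _; rewrite sumEFin.
  exact: le_trans (bessel_section eo (far_section_L2 x)) (kfA x).
Qed.

End TraceBound.

(** * Smooth functions in the plane *)

Section PlaneCalculus.
Variable R : realType.

Lemma is_derive_line (V W : normedModType R) (f : V -> W) (a v : V) (t : R) df :
  is_derive (a + t *: v) v f df <-> is_derive t 1 (fun s => f (a + s *: v)) df.
Proof.
have E : (fun h : R => h^-1 *: ((f \o shift (a + t *: v)) (h *: v) - f (a + t *: v))) =
    (fun h : R => h^-1 *: (((fun s => f (a + s *: v)) \o shift t) (h *: 1) - f (a + t *: v))).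
  apply/funext => h /=; congr (_ *: (f _ - _)).
  by rewrite addrCA -scalerDl [h *: 1]mulr1.
pose phi (s : R) := f (a + s *: v).
have Ed : derivable f (a + t *: v) v = derivable (phi : R -> W) t 1.
  by rewrite /derivable E.
have Ev : 'D_v f (a + t *: v) = derive (phi : R -> W) t 1.
  by rewrite /derive E.
split=> -[ex dv]; split.
- by rewrite -Ed.
- by rewrite -Ev.
- by rewrite Ed.
- by rewrite Ev.
Qed.

Implicit Types (g : R * R -> R) (u v h : R * R).

Lemma derive_plane g u h : differentiable g u ->
  'D_h g u = h.1 * dg1 g u + h.2 * dg2 g u.
Proof.
move=> dg; rewrite /dg1 /dg2 !deriveE //.
have -> : h = h.1 *: ((1, 0) : R * R) + h.2 *: ((0, 1) : R * R).
  apply: injective_projections => /=.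
    by rewrite [_ *: 1]mulr1 [_ *: 0]mulr0 addr0.
  by rewrite [_ *: 1]mulr1 [_ *: 0]mulr0 add0r.
rewrite linearD !linearZ /=; congr (_ * _ + _ * _).
  by rewrite [_ *: 1]mulr1 [_ *: 0]mulr0 addr0.
by rewrite [_ *: 1]mulr1 [_ *: 0]mulr0 add0r.
Qed.

Lemma is_derive_segment g u h (t : R) : (forall x, differentiable g x) ->
  is_derive t 1 (fun s => g (u + s *: h))
    (h.1 * dg1 g (u + t *: h) + h.2 * dg2 g (u + t *: h)).
Proof.
move=> dg; have := derivableP (diff_derivable (v := h) (dg (u + t *: h))).
by rewrite (derive_plane _ (dg _)) => /(proj1 (is_derive_line _ _ _ _ _)).
Qed.

(** A product of segments: compact, so that continuous functions are bounded on it, and convex, so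
    that Taylor's formula can be used along segments. *)
Definition square (rho : R) : set (R * R) := [set u | `|u.1| <= rho /\ `|u.2| <= rho].

Lemma square_segment rho u v (t : R) : square rho u -> square rho v -> 0 <= t <= 1 ->
  square rho (u + t *: (v - u)).
Proof.
move=> [u1 u2] [v1 v2] /andP[t0 t1].
have key (a b : R) : `|a| <= rho -> `|b| <= rho -> `|a + t * (b - a)| <= rho.
  move=> ha hb; have -> : a + t * (b - a) = (1 - t) * a + t * b by ring.
  have -> : rho = (1 - t) * rho + t * rho by ring.
  apply: le_trans (ler_normD _ _) _; rewrite !normrM.
  rewrite (ger0_norm t0) ger0_norm ?subr_ge0 //.
  by apply: lerD; apply: ler_wpM2l; rewrite ?subr_ge0.
by split; exact: key.
Qed.

Lemma mulr_sqr_bounds (x y : R) :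
  [/\ `|x * x| <= x ^+ 2 + y ^+ 2, `|x * y| <= x ^+ 2 + y ^+ 2 &
      `|y * y| <= x ^+ 2 + y ^+ 2].
Proof.
have qx := sqr_ge0 x; have qy := sqr_ge0 y.
have hm := sqr_ge0 (x - y); have hp := sqr_ge0 (x + y).
rewrite sqrrB sqrrD in hm hp *.
split; rewrite -?expr2 ler_norml; apply/andP; split; lra.
Qed.

Lemma continuous_square_bounded g rho : continuous g ->
  exists M, 0 <= M /\ forall u, square rho u -> `|g u| <= M.
Proof.
move=> cg.
have cK : compact (`[- rho, rho]%classic `*` `[- rho, rho]%classic : set (R * R)).
  by apply: compact_setX; exact: segment_compact.
have := continuous_compact (continuous_subspaceT cg) cK.
move=> /compact_bounded[M [_ hM]]; exists (`|M| + 1); split; first by rewrite addr_ge0.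
move=> u [u1 u2]; apply: (hM (`|M| + 1)).
  by rewrite (le_lt_trans (ler_norm _)) // ltrDl.
exists u => //; split => /=; rewrite in_itv /=.
  by rewrite -ler_norml.
by rewrite -ler_norml.
Qed.

Lemma smooth_diff g : smooth g -> forall u, differentiable g u.
Proof. by move=> sg u; exact: (sg [::] u). Qed.

Lemma smooth_dg g : smooth g -> smooth (dg1 g) /\ smooth (dg2 g).
Proof.
move=> sg; split=> vs u; first by have := sg (rcons vs (1, 0)) u; rewrite foldr_rcons.
by have := sg (rcons vs (0, 1)) u; rewrite foldr_rcons.
Qed.

Lemma smooth_continuous g : smooth g -> continuous g.
Proof. by move=> sg u; apply: differentiable_continuous; exact: smooth_diff. Qed.

(** The mean value theorem twice along the segment: for phi(s) = g(u + s (v - u)) on [0, 1], giving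
    a point c, then for phi' on [0, c]. The constant adds bounds for the four second derivatives on
    the square. *)
Lemma taylor2 g rho : smooth g -> exists M, 0 <= M /\ forall u v,
  square rho u -> square rho v ->
  `|g v - g u - ((v.1 - u.1) * dg1 g u + (v.2 - u.2) * dg2 g u)| <=
    M * ((v.1 - u.1) ^+ 2 + (v.2 - u.2) ^+ 2).
Proof.
move=> sg; have [s1 s2] := smooth_dg sg.
have [s11 s12] := smooth_dg s1; have [s21 s22] := smooth_dg s2.
have [M11 [p11 b11]] := continuous_square_bounded rho (smooth_continuous s11).
have [M12 [p12 b12]] := continuous_square_bounded rho (smooth_continuous s12).
have [M21 [p21 b21]] := continuous_square_bounded rho (smooth_continuous s21).
have [M22 [p22 b22]] := continuous_square_bounded rho (smooth_continuous s22).
exists (M11 + M12 + M21 + M22); split; first by rewrite !addr_ge0.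
move=> u v uS vS; pose h := v - u.
have h1 : v.1 - u.1 = h.1 by [].
have h2 : v.2 - u.2 = h.2 by [].
rewrite h1 h2; pose dphi t := h.1 * dg1 g (u + t *: h) + h.2 * dg2 g (u + t *: h).
pose ddphi t := h.1 * (h.1 * dg1 (dg1 g) (u + t *: h) + h.2 * dg2 (dg1 g) (u + t *: h))
  + h.2 * (h.1 * dg1 (dg2 g) (u + t *: h) + h.2 * dg2 (dg2 g) (u + t *: h)).
have d1 (t : R) : is_derive t 1 (fun s => g (u + s *: h)) (dphi t).
  by apply: is_derive_segment; exact: smooth_diff.
have d2 (t : R) : is_derive t 1 dphi (ddphi t).
  have e1 := is_derive_segment u h t (smooth_diff s1).
  have e2 := is_derive_segment u h t (smooth_diff s2).
  exact: (is_deriveD (is_deriveZ h.1 e1) (is_deriveZ h.2 e2)).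
have [c c01 Ec] : exists2 c : R, c \in `[0, 1]%R & g v - g u = dphi c.
  have [|c c01 Ec] := @MVT_segment R (fun s => g (u + s *: h)) dphi 0 1 ler01 (fun x _ => d1 x).
    by apply: derivable_within_continuous => x _; have [] := d1 x.
  exists c => //; move: Ec; rewrite subr0 mulr1 scale1r scale0r addr0 => <-.
  by rewrite /h addrCA subrr addr0.
have [c0 c1] : 0 <= c /\ c <= 1 by move: c01; rewrite in_itv => /andP.
have [b b0c Eb] : exists2 b : R, b \in `[0, c]%R & dphi c - dphi 0 = ddphi b * c.
  have [|b b0c Eb] := @MVT_segment R dphi ddphi 0 c c0 (fun x _ => d2 x).
    apply: derivable_within_continuous => x _.
    by have [] := d2 x.
  by exists b => //; rewrite Eb subr0.
have [b0 bc] : 0 <= b /\ b <= c by move: b0c; rewrite in_itv => /andP.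
have -> : h.1 * dg1 g u + h.2 * dg2 g u = dphi 0 by rewrite /dphi scale0r addr0.
rewrite Ec Eb.
have wS : square rho (u + b *: h).
  by apply: square_segment => //; rewrite b0 (le_trans bc).
have B11 := b11 _ wS; have B12 := b12 _ wS.
have B21 := b21 _ wS; have B22 := b22 _ wS.
rewrite normrM (ger0_norm c0).
apply: (@le_trans _ _ `|ddphi b|); first by rewrite ler_piMr.
rewrite /ddphi; move: B11 B12 B21 B22.
set A11 := dg1 _ _; set A12 := dg2 (dg1 g) _; set A21 := dg1 (dg2 g) _.
set A22 := dg2 (dg2 g) _; set x := h.1; set y := h.2.
move=> B11 B12 B21 B22; pose q := x ^+ 2 + y ^+ 2.
have key (p A M : R) : `|A| <= M -> `|p| <= q -> `|p * A| <= M * q.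
  by move=> AM pq; rewrite normrM mulrC; apply: ler_pM.
have [qxx qxy qyy] := mulr_sqr_bounds x y.
have K11 : `|x * x * A11| <= M11 * q by exact: key.
have K12 : `|x * y * A12| <= M12 * q by exact: key.
have K21 : `|y * x * A21| <= M21 * q by apply: key; rewrite // mulrC.
have K22 : `|y * y * A22| <= M22 * q by exact: key.
rewrite (_ : x * (x * A11 + y * A12) + y * (x * A21 + y * A22) =
  x * x * A11 + x * y * A12 + y * x * A21 + y * y * A22); last by ring.
rewrite -/q (_ : (M11 + M12 + M21 + M22) * q = M11 * q + M12 * q + M21 * q + M22 * q);
  last by ring.
by do 3![apply: le_trans (ler_normD _ _) _; apply: lerD => //].
Qed.

End PlaneCalculus.

(** * The directional derivative of the Newton kernel *)

Section NewtonDerivative.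
Variable R : realType.
Implicit Types x y v w : 'rV[R]_3.

Definition dot v w : R := \sum_i v 0 i * w 0 i.

Lemma enorm_ge0 n (x : 'rV[R]_n) : 0 <= enorm x.
Proof. exact: sqrtr_ge0. Qed.

Lemma sqr_enorm_sum x : enorm x ^+ 2 = \sum_i x 0 i ^+ 2.
Proof.
by rewrite sqr_sqrtr //; apply: sumr_ge0 => i _; rewrite sqr_ge0.
Qed.

Lemma sqr_enorm x : enorm x ^+ 2 = dot x x.
Proof.
by rewrite sqr_enorm_sum; apply: eq_bigr => i _; rewrite expr2.
Qed.

Lemma enorm_eq0 x : (enorm x == 0) = (x == 0).
Proof.
apply/eqP/eqP => [x0|->]; last first.
  by rewrite /enorm big1 ?sqrtr0 // => i _; rewrite mxE expr0n.
have : \sum_i x 0 i ^+ 2 = 0.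
  by rewrite -sqr_enorm_sum x0 expr0n.
move/eqP; rewrite psumr_eq0; last by move=> i _; rewrite sqr_ge0.
move=> /allP h; apply/rowP => i; rewrite mxE; apply/eqP.
by have := h i (mem_index_enum _); rewrite /= sqrf_eq0.
Qed.

Lemma enormN x : enorm (- x) = enorm x.
Proof.
by rewrite /enorm; congr Num.sqrt; apply: eq_bigr => i _; rewrite mxE sqrrN.
Qed.

Lemma enormBC x y : enorm (x - y) = enorm (y - x).
Proof. by rewrite -enormN opprB. Qed.

Lemma enormZ (a : R) x : enorm (a *: x) = `|a| * enorm x.
Proof.
rewrite /enorm; under eq_bigr do rewrite mxE exprMn.
by rewrite -mulr_sumr sqrtrM ?sqr_ge0 // sqrtr_sqr.
Qed.

Let c0 : R := (2 * pi)^-1.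

Lemma is_derive_sqr_affine (a b : R) :
  is_derive (0 : R) 1 (fun s => (a - s * b) ^+ 2) (- 2 * (b * a)).
Proof.
have h : is_derive (0 : R) 1 (cst a - ( *:%R^~ b : R -> R)) (0 - b).
  apply: is_deriveB.
  have -> : ( *:%R^~ b : R -> R) = b *: (id : R -> R).
    by apply/funext => s; rewrite /= /GRing.scale /= mulrC.
  have := is_deriveZ b (is_derive_id (0 : R) (1 : R)).
  by rewrite [_ *: 1]mulr1.
have := is_deriveX 2 h.
rewrite /GRing.scale /= expr1 sub0r [X in is_derive _ _ _ X](_ : _ = - 2 * (b * a)) //.
rewrite -[(cst a - _) 0]/(a - 0 * b); ring.
Qed.

Lemma derive_newton_off x y v : x != y ->
  'D_v (newton x) y = c0 * (dot v (x - y) / enorm (x - y) ^+ 3).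
Proof.
move=> xy; have e0 : 0 < enorm (x - y).
  by rewrite lt_neqAle eq_sym enorm_eq0 subr_eq0 xy enorm_ge0.
pose q (s : R) := \sum_i ((x - y) 0 i - s * v 0 i) ^+ 2.
have q0 : q 0 = enorm (x - y) ^+ 2.
  rewrite sqr_enorm; apply: eq_bigr => i _.
  by rewrite mul0r subr0 expr2.
have dq : is_derive (0 : R) 1 q (- 2 * dot v (x - y)).
  have -> : q = \sum_i (fun s : R => ((x - y) 0 i - s * v 0 i) ^+ 2).
    by apply/funext => s; rewrite fct_sumE.
  rewrite /dot mulr_sumr; apply: is_derive_sum => i.
  exact: is_derive_sqr_affine.
have q0p : 0 < q 0 by rewrite q0 exprn_gt0.
have sq0 : Num.sqrt (q 0) = enorm (x - y) by rewrite q0 sqrtr_sqr ger0_norm // ltW.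
have ds : is_derive (0 : R) 1 (fun s => c0 * (Num.sqrt (q s))^-1)
    (c0 * (dot v (x - y) / enorm (x - y) ^+ 3)).
  have h1 := is_derive1_sqrt q0p.
  have h2 := is_derive1_comp h1 dq.
  have ne : (Num.sqrt \o q) 0 != 0 by rewrite /= sq0 gt_eqF.
  have h3 := is_deriveV ne h2.
  have := is_deriveZ c0 h3; rewrite /= sq0.
  suff -> : c0 *: (- enorm (x - y) ^- 2 *:
    ((2 * enorm (x - y))^-1 * (- 2 * dot v (x - y)))) =
    c0 * (dot v (x - y) / enorm (x - y) ^+ 3) by [].
  rewrite /GRing.scale /=; congr (_ * _); field.
  by rewrite gt_eqF.
have : is_derive (y + 0 *: v) v (newton x) (c0 * (dot v (x - y) / enorm (x - y) ^+ 3)).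
  apply/is_derive_line.
  suff -> : (fun s => newton x (y + s *: v)) = (fun s => c0 * (Num.sqrt (q s))^-1) by [].
  apply/funext => s; rewrite /newton /enorm; congr (_ * (Num.sqrt _)^-1).
  by apply: eq_bigr => i _; rewrite !mxE opprD addrA.
by rewrite scale0r addr0 => -[].
Qed.

(* newton x x = 0 and, for v != 0, the difference quotient diverges, so that its
   lim is the default value 0. *)
Lemma derive_newton_diag x v : 'D_v (newton x) x = 0.
Proof.
have [->|v0] := eqVneq v 0; first exact: derive0.
have e0 : 0 < enorm v by rewrite lt_neqAle eq_sym enorm_eq0 v0 enorm_ge0.
pose c := c0 / enorm v.
have c_gt0 : 0 < c by apply: divr_gt0 => //; rewrite invr_gt0 mulr_gt0 // pi_gt0.
rewrite /derive.
set f := (fun h : R => h^-1 *: ((newton x \o shift x) (h *: v) - newton x x)).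
have fE h : 0 < h -> f h = c / h ^+ 2.
  move=> h0; rewrite /f /newton /= subrr opprD addrCA subrr addr0 enormN enormZ gtr0_norm //.
  rewrite (_ : enorm 0 = 0); last by apply/eqP; rewrite enorm_eq0.
  rewrite invr0 mulr0 subr0 /GRing.scale /= /c -/c0; move: c0 => C; field.
  by rewrite !gt_eqF.

rewrite /lim /lim_in getPN // => l fl.
have : \forall h \near (0 : R)^', `|l - f h| < 1.
  by move/cvgrPdist_lt : fl; apply.
move=> [d /= d0 hd].
(* h <= 1 and h <= c / (|l| + 1) give c / h^2 >= |l| + 1, so the quotient stays at distance at least
   1 from [l]; h <= d / 2 keeps [h] in the given neighbourhood. *)
pose h := Num.min (d / 2) (Num.min 1 (c / (`|l| + 1))).
have l0 : 0 < `|l| + 1 by rewrite ltr_wpDl.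
have h0 : 0 < h by rewrite /h !lt_min ltr01 (divr_gt0 d0) //= (divr_gt0 c_gt0).
have h1 : h <= 1 by rewrite /h !ge_min lexx !orbT.
have hc : h <= c / (`|l| + 1) by rewrite /h !ge_min lexx !orbT.
have hd2 : h <= d / 2 by rewrite /h ge_min lexx.
have : `|l - f h| < 1.
  apply: hd; last by rewrite gt_eqF.
  by rewrite /= sub0r normrN gtr0_norm //; lra.
apply/negP; rewrite -leNgt fE //.
have big : `|l| + 1 <= c / h ^+ 2.
  rewrite ler_pdivlMr ?exprn_gt0 // mulrC -ler_pdivlMr //.
  by apply: le_trans hc; rewrite expr2 ger_pMr.
rewrite distrC; apply: le_trans (lerB_dist _ _).
rewrite (gtr0_norm (divr_gt0 c_gt0 (exprn_gt0 2 h0))).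
by rewrite lerBrDr addrC.
Qed.

(** On the diagonal the formula gives 0, which is also the default value of the derivative there, so
    later estimates can use one formula. *)
Lemma derive_newton x y v :
  'D_v (newton x) y = c0 * (dot v (x - y) / enorm (x - y) ^+ 3).
Proof.
have [<-|xy] := eqVneq x y; last exact: derive_newton_off.
rewrite derive_newton_diag subrr /dot big1 ?mul0r ?mulr0 // => i _.
by rewrite mxE mulr0.
Qed.

End NewtonDerivative.

(** * Dyadic estimates of weakly singular kernels *)

(** 1/f is f times the power -1 of f^2, whose base is nonnegative, so measurability of real powers
    applies. Zeros of f give 0 on both sides. *)
Lemma measurable_funV d (T : measurableType d) (R : realType) (D : set T) (f : T -> R) :
  measurable_fun D f -> measurable_fun D (fun x => (f x)^-1).
Proof.
move=> mf; have -> : (fun x => (f x)^-1) = (fun x => f x * (f x ^+ 2) `^ (- 1)).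
  apply/funext => x; rewrite powR_inv1 ?sqr_ge0 //.
  have [->|f0] := eqVneq (f x) 0; first by rewrite invr0 mul0r.
  by field.
apply: measurable_funM => //.
apply: (measurableT_comp (measurable_powR _)).
exact: measurable_funX.
Qed.

Section Dyadic.
Context d (X : measurableType d) (R : realType).
Variable mu : {finite_measure set X -> \bar R}.
Variables (rho : X -> X -> R) (C : R).
Hypotheses (rho_ge0 : forall x y, 0 <= rho x y)
  (rhoC : forall x y, rho x y = rho y x) (mrho : mkernel rho).
Hypothesis C0 : 0 < C.

Definition rball x r : set X := [set y | rho x y < r].

Hypothesis growth : forall x r, 0 < r -> (mu (rball x r) <= (C * r ^+ 2)%:E)%E.

Definition shell x j : set X := [set y | 2 ^- j.+1 <= rho x y < 2 ^- j].

Lemma measurable_shell x j : measurable (shell x j).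
Proof.
have m := mkernel_section x mrho.
have := m measurableT `[2 ^- j.+1, 2 ^- j[%classic (measurable_itv _).
by rewrite setTI; congr measurable.
Qed.

Lemma shell_measure x j : (mu (shell x j) <= (C * 4 ^- j)%:E)%E.
Proof.
have -> : (4 : R) ^- j = (2 ^- j) ^+ 2.
  have -> : (4 : R) = 2 ^+ 2 by rewrite expr2 -natrM.
  by rewrite exprVn -!exprM mulnC.
apply: le_trans (growth x _); last by rewrite invr_gt0 exprn_gt0.
apply: le_measure; rewrite ?inE.
- exact: measurable_shell.
- have := mkernel_section x mrho measurableT (measurable_itv `]-oo, (2 ^- j)[).
  by rewrite setTI; congr measurable.
- by move=> y /= /andP[].
Qed.

(** The half-open shells tile the punctured ball. The least n with 2^-n <= rho exceeds m, and the
    shell has index n - 1. *)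
Lemma exists_shell x y m : 0 < rho x y -> rho x y < 2 ^- m ->
  exists j, shell x (m + j) y.
Proof.
move=> r0 rm.
have ex : exists n, 2 ^- n <= rho x y.
  have [n hn] : exists n : nat, (rho x y)^-1 < n%:R.
    by exists (Num.bound (rho x y)^-1); rewrite archi_boundP // invr_ge0 ltW.
  exists n; rewrite invf_ple ?posrE ?exprn_gt0 //; apply: ltW; apply: lt_le_trans hn _.
  by rewrite -natrX ler_nat ltnW // ltn_expl.
case: (@ex_minnP (fun n => 2 ^- n <= rho x y) ex) => n hn min.
have mn : (m < n)%N.
  rewrite ltnNge; apply/negP => nm.
  have : (2 : R) ^- m <= 2 ^- n by rewrite lef_pV2 ?posrE ?exprn_gt0 // ler_eXn2l // ltr1n.
  by move=> /le_trans /(_ hn); rewrite leNgt rm.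
case: n hn min mn => [//|n] hn min mn.
exists (n - m)%N; rewrite /shell /= subnKC // hn /= ltNge; apply/negP => /min.
by rewrite ltnn.
Qed.

(* 1/rho <= 2^(j+1) on the shell j, whose measure is at most C 4^-j. *)
Lemma near_integral x m :
  (\int[mu]_y (if rho x y < 2 ^- m then (rho x y)^-1 else 0)%:E <= (4 * C * 2 ^- m)%:E)%E.
Proof.
pose w i (y : X) : \bar R := ((2 ^+ (m + i).+1) * \1_(shell x (m + i)) y)%:E.
have mw i : measurable_fun setT (w i).
  apply/measurable_EFinP; apply: measurable_funM => //.
  by apply: measurable_indic; exact: measurable_shell.
have w0 i y : (0 <= w i y)%E by rewrite lee_fin mulr_ge0 // exprn_ge0.
have mx := mkernel_section x mrho.
have mf : measurable_fun setT (fun y => (if rho x y < 2 ^- m then (rho x y)^-1 else 0)%:E).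
  apply/measurable_EFinP; apply: measurable_fun_ifT => //.
    by apply: measurable_fun_ltr.
  exact: measurable_funV.
apply: (@le_trans _ _ (\int[mu]_y (\sum_(i <oo) w i y))%E).
  apply: ge0_le_integral => //.
  - by move=> y _; rewrite lee_fin; case: ifP => // _; rewrite invr_ge0.
  - by apply: ge0_emeasurable_sum.
  - move=> y _; case: ifP => [rm|_]; last by apply: nneseries_ge0.
    (* The centre lies in no shell, but the inverse of 0 is 0. *)
    have [r0|r0] := ltP 0 (rho x y); last first.
      have -> : rho x y = 0 by apply/eqP; rewrite eq_le r0 rho_ge0.
      by rewrite invr0; apply: nneseries_ge0.
    have [j hj] := exists_shell r0 rm.
    apply: (@le_trans _ _ (w j y)).
      rewrite /w indicE mem_set // mulr1 lee_fin.
      have /andP[h _] := hj; rewrite -[leRHS]invrK lef_pV2 ?posrE ?invr_gt0 ?exprn_gt0 //.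
    apply: le_trans (nneseries_lim_ge j.+1 _) => //.
    by rewrite big_nat_recr //= leeDr // sume_ge0.
rewrite integral_nneseries //.
(* The term of index i is 2^(m+i+1) C 4^-(m+i), that is 4 C 2^-m divided by 2^(i+1). *)
apply: le_trans (epsilon_trick0 xpredT _); last by rewrite !mulr_ge0 ?invr_ge0 ?exprn_ge0 // ltW.
apply: lee_nneseries => [i *|i *]; first by apply: integral_ge0 => y _; exact: w0.
rewrite /w; under eq_integral do rewrite EFinM.
rewrite ge0_integralZl_EFin //; last first.
  by apply/measurable_EFinP; apply: measurable_indic; exact: measurable_shell.
rewrite integral_indic // ?setIT; last exact: measurable_shell.
apply: (@le_trans _ _ ((2 ^+ (m + i).+1)%:E * (C * 4 ^- (m + i))%:E)%E).
  by rewrite lee_pmul2l ?lte_fin ?exprn_gt0 //; exact: shell_measure.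
rewrite -EFinM lee_fin natrX.
have -> : (4 : R) = 2 * 2 by rewrite -natrM.
rewrite exprMn [(2 : R) ^+ i.+1]exprS [(2 : R) ^+ (m + i).+1]exprS exprD.
have a0 : (2 : R) ^+ m != 0 by rewrite expf_neq0.
have b0 : (2 : R) ^+ i != 0 by rewrite expf_neq0.
rewrite le_eqVlt; apply/orP; left; apply/eqP; field.
by rewrite a0 b0.
Qed.


Let V := fine (mu setT).
Let muT : mu setT = V%:E. Proof. by rewrite /V fineK // fin_num_measure. Qed.

Let muT_le : (mu setT <= V%:E)%E. Proof. by rewrite muT. Qed.

Lemma measurable_cut (f g : X -> R) x m : measurable_fun setT f -> measurable_fun setT g ->
  measurable_fun setT (fun y => if rho x y < 2 ^- m then f y else g y).
Proof.
move=> mf mg; apply: measurable_fun_ifT => //.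
by apply: measurable_fun_ltr => //; exact: mkernel_section.
Qed.

(** On shell j the integrand is at most 4^(j+1) and the measure at most C 4^-j, so each of the m
    shells adds at most 4 C; the region rho >= 1 adds at most the total mass. *)
Lemma far_integral x m :
  (\int[mu]_y (if rho x y < 2 ^- m then 0 else (rho x y)^-1 ^+ 2)%:E <=
    (V + 4 * C * m%:R)%:E)%E.
Proof.
pose w i (y : X) : \bar R := ((4 ^+ i.+1) * \1_(shell x i) y)%:E.
have mw i : measurable_fun setT (w i).
  apply/measurable_EFinP; apply: measurable_funM => //.
  by apply: measurable_indic; exact: measurable_shell.
have w0 i y : (0 <= w i y)%E by rewrite lee_fin mulr_ge0 // exprn_ge0.
have mx := mkernel_section x mrho.
apply: (@le_trans _ _ (\int[mu]_y (1%:E + \sum_(i < m) w i y))%E).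
  apply: ge0_le_integral => //.
  - by move=> y _; rewrite lee_fin; case: ifP => // _; rewrite sqr_ge0.
  - apply/measurable_EFinP; apply: measurable_cut => //.
    by apply: measurable_funX; exact: measurable_funV.
  - by apply: emeasurable_funD => //; apply: emeasurable_sum => i; exact: mw.
  - move=> y _; have s0 : (0 <= \sum_(i < m) w i y)%E by apply: sume_ge0.
    case: ifP => [_|/negbT]; first by rewrite adde_ge0.
    rewrite -leNgt => mr; have r0 : 0 < rho x y by apply: lt_le_trans mr; rewrite invr_gt0 exprn_gt0.
    have [r1|r1] := ltP (rho x y) 1; last first.
      apply: (@le_trans _ _ 1%:E); last by rewrite leeDl.
      by rewrite lee_fin exprn_ile1 ?invr_ge0 ?(ltW r0) // invf_le1.
    have r1' : rho x y < 2 ^- 0 by rewrite expr0 invr1.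
    have [j] := exists_shell r0 r1'; rewrite add0n => hj.
    have /andP[h1 h2] := hj.
    have jm : (j < m)%N.
      rewrite ltnNge; apply/negP => nm.
      have : (2 : R) ^- j <= 2 ^- m by rewrite lef_pV2 ?posrE ?exprn_gt0 // ler_eXn2l // ltr1n.
      by move=> /(lt_le_trans h2); rewrite ltNge mr.
    apply: (@le_trans _ _ (w j y)); last first.
      rewrite (bigD1 (Ordinal jm)) //= addeCA leeDl // adde_ge0 //.
      exact: sume_ge0.
    rewrite /w indicE mem_set // mulr1 lee_fin.
    have -> : (4 : R) = 2 ^+ 2 by rewrite expr2 -natrM.
    rewrite -exprM mulnC exprM lerXn2r ?nnegrE ?invr_ge0 ?exprn_ge0 //.
    by rewrite -[leRHS]invrK lef_pV2 ?posrE ?invr_gt0 ?exprn_gt0.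
rewrite ge0_integralD //; last 2 first.
- by move=> y _; apply: sume_ge0.
- by apply: emeasurable_sum => i; exact: mw.
rewrite EFinD; apply: leeD; first by rewrite integral_cst // mul1e; exact: muT_le.
rewrite ge0_integral_sum //.
apply: (@le_trans _ _ (\sum_(i < m) (4 * C)%:E)%E); last first.
  by rewrite sumEFin lee_fin sumr_const card_ord mulr_natr.
apply: lee_sum => i _.
rewrite /w; under eq_integral do rewrite EFinM.
rewrite ge0_integralZl_EFin //; last first.
  by apply/measurable_EFinP; apply: measurable_indic; exact: measurable_shell.
rewrite integral_indic // ?setIT; last exact: measurable_shell.
apply: (@le_trans _ _ ((4 ^+ i.+1)%:E * (C * 4 ^- i)%:E)%E).
  by rewrite lee_pmul2l ?lte_fin ?exprn_gt0 //; exact: shell_measure.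
rewrite -EFinM lee_fin exprS.
have a0 : (4 : R) ^+ i != 0 by rewrite expf_neq0.
by rewrite le_eqVlt; apply/orP; left; apply/eqP; field.
Qed.

Variables (k : X -> X -> R) (M : R).
Hypotheses (mk : mkernel k) (M0 : 0 < M).
Hypothesis kM : forall x y, `|k x y| <= M * (rho x y)^-1.

Definition knear m x y := if rho x y < 2 ^- m then k x y else 0.
Definition kfar m x y := if rho x y < 2 ^- m then 0 else k x y.

Lemma knear_kfar m x y : kfar m x y + knear m x y = k x y.
Proof. by rewrite /kfar /knear; case: ifP; rewrite ?addr0 ?add0r. Qed.

Lemma mkernel_knear m : mkernel (knear m).
Proof.
apply: measurable_fun_ifT => //.
exact: measurable_fun_ltr.
Qed.

Lemma mkernel_kfar m : mkernel (kfar m).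
Proof.
apply: measurable_fun_ifT => //.
exact: measurable_fun_ltr.
Qed.

(** [f] stands for a row or a column of the kernel, so that one estimate serves both halves of the
    Schur condition. *)
Lemma near_majorant (f : X -> R) x m : measurable_fun setT f ->
  (forall y, `|f y| <= if rho x y < 2 ^- m then M * (rho x y)^-1 else 0) ->
  (\int[mu]_y `|f y|%:E <= (M * (4 * C * 2 ^- m))%:E)%E.
Proof.
move=> mf fM.
have mi : measurable_fun setT (fun y => (if rho x y < 2 ^- m then (rho x y)^-1 else 0)%:E).
  apply/measurable_EFinP; apply: measurable_cut => //.
  by apply: measurable_funV; exact: mkernel_section.
apply: (@le_trans _ _ (\int[mu]_y (M%:E *
   (if rho x y < 2 ^- m then (rho x y)^-1 else 0)%:E))%E).
  apply: ge0_le_integral => //.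
  - by apply/measurable_EFinP; exact: measurableT_comp.
  - exact: measurable_funeM.
  - move=> y _; rewrite -EFinM lee_fin; apply: le_trans (fM y) _.
    by case: ifP; rewrite ?mulr0.
rewrite ge0_integralZl_EFin ?(ltW M0) //.
  by rewrite EFinM lee_pmul2l ?lte_fin //; exact: near_integral.
by move=> y _; rewrite lee_fin; case: ifP => // _; rewrite invr_ge0.
Qed.

Lemma mkernel_section2 (l : X -> X -> R) y : mkernel l -> measurable_fun setT (l^~ y).
Proof. by move=> ml; exact: (measurableT_comp ml (pair2_measurable y)). Qed.

Lemma schur_knear m : schur mu (knear m) (M * (4 * C * 2 ^- m)).
Proof.
have mn := mkernel_knear m.
split=> // [x|y].
  apply: (@near_majorant _ x); first exact: mkernel_section.
  by move=> y; rewrite /knear; case: ifP => // _; rewrite normr0.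
apply: (@near_majorant _ y); first exact: mkernel_section2.
by move=> x; rewrite /knear rhoC; case: ifP => // _; rewrite ?normr0 // rhoC.
Qed.

Lemma kfar_energy m x :
  (\int[mu]_y (kfar m x y ^+ 2)%:E <= (M ^+ 2 * (V + 4 * C * m%:R))%:E)%E.
Proof.
have mi : measurable_fun setT (fun y => (if rho x y < 2 ^- m then 0 else (rho x y)^-1 ^+ 2)%:E).
  apply/measurable_EFinP; apply: measurable_cut => //.
  by apply: measurable_funX; apply: measurable_funV; exact: mkernel_section.
apply: (@le_trans _ _ (\int[mu]_y ((M ^+ 2)%:E *
   (if rho x y < 2 ^- m then 0 else (rho x y)^-1 ^+ 2)%:E))%E).
  apply: ge0_le_integral => //.
  - by move=> y _; rewrite lee_fin sqr_ge0.
  - apply/measurable_EFinP; apply: measurable_funX; apply: mkernel_section.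
    exact: mkernel_kfar.
  - exact: measurable_funeM.
  - move=> y _; rewrite -EFinM lee_fin /kfar; case: ifP => _.
      by rewrite expr0n mulr0.
    rewrite -exprMn -real_normK ?num_real // lerXn2r ?nnegrE //.
    by rewrite mulr_ge0 ?invr_ge0 // ltW.
rewrite ge0_integralZl_EFin ?sqr_ge0 //.
  by rewrite [leRHS]EFinM lee_pmul2l ?lte_fin ?exprn_gt0 //; exact: far_integral.
by move=> y _; rewrite lee_fin; case: ifP => // _; rewrite sqr_ge0.
Qed.

(** Within distance 1 this is the near estimate with m = 0; beyond it |k| <= M, and the total mass
    is V. *)
Lemma schur_kernel : schur mu k (M * (4 * C + V)).
Proof.
have V0 : 0 <= V by rewrite -lee_fin -muT.
have key (f : X -> R) x : measurable_fun setT f ->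
    (forall y, `|f y| <= M * (rho x y)^-1) ->
    (\int[mu]_y `|f y|%:E <= (M * (4 * C + V))%:E)%E.
  move=> mf fM.
  pose fn y := if rho x y < 2 ^- 0 then f y else 0.
  have mfn : measurable_fun setT fn by exact: measurable_cut.
  apply: (@le_trans _ _ (\int[mu]_y (`|fn y|%:E + M%:E))%E).
    apply: ge0_le_integral => //.
    - by apply/measurable_EFinP; exact: measurableT_comp.
    - by apply: emeasurable_funD => //; apply/measurable_EFinP; exact: measurableT_comp.
    - move=> y _; rewrite -EFinD lee_fin /fn; case: ifP => [_|/negbT].
        by rewrite lerDl ltW.
      rewrite -leNgt expr0 invr1 normr0 add0r => r1; apply: le_trans (fM y) _.
      by rewrite ler_piMr ?(ltW M0) // invf_le1 // (lt_le_trans ltr01).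
  rewrite ge0_integralD //; last 2 first.
  - by apply/measurable_EFinP; exact: measurableT_comp.
  - by move=> y _; rewrite lee_fin ltW.
  rewrite mulrDr EFinD; apply: leeD; last first.
    by rewrite integral_cst // EFinM lee_pmul2l ?lte_fin //; exact: muT_le.
  have := @near_majorant fn x 0 mfn; rewrite expr0 invr1 mulr1; apply=> y.
  by rewrite /fn expr0 invr1; case: ifP => // _; rewrite normr0.
split=> // [x|y]; first by apply: (key _ x) => //; exact: mkernel_section.
apply: (key _ y); first exact: mkernel_section2.
by move=> x; rewrite rhoC.
Qed.

End Dyadic.

(** * Boundary charts *)

Section Euclid.
Variable R : realType.
Implicit Types (x y v w : 'rV[R]_3) (Q : 'M[R]_3).

Lemma dotE v w : dot v w = (v *m w^T) 0 0.
Proof. by rewrite mxE; apply: eq_bigr => i _; rewrite mxE. Qed.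

Lemma dotC v w : dot v w = dot w v.
Proof. by apply: eq_bigr => i _; rewrite mulrC. Qed.

Lemma dotZl (a : R) v w : dot (a *: v) w = a * dot v w.
Proof. by rewrite /dot mulr_sumr; apply: eq_bigr => i _; rewrite mxE mulrA. Qed.

Lemma dotDl v v' w : dot (v + v') w = dot v w + dot v' w.
Proof. by rewrite /dot -big_split; apply: eq_bigr => i _; rewrite mxE mulrDl. Qed.

Lemma dotDr v w w' : dot v (w + w') = dot v w + dot v w'.
Proof. by rewrite dotC dotDl !(dotC v). Qed.

Lemma dotZr (a : R) v w : dot v (a *: w) = a * dot v w.
Proof. by rewrite dotC dotZl dotC. Qed.

Lemma dotvv_ge0 v : 0 <= dot v v.
Proof. by rewrite -sqr_enorm sqr_ge0. Qed.

Lemma dot_CauchySchwarz v w : `|dot v w| <= enorm v * enorm w.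
Proof.
rewrite -ler_sqr ?nnegrE ?mulr_ge0 ?enorm_ge0 // real_normK ?num_real //.
rewrite exprMn !sqr_enorm.
have [w0|w0] := eqVneq (dot w w) 0.
  have -> : w = 0 by apply/eqP; rewrite -enorm_eq0 -sqrf_eq0 sqr_enorm w0.
  rewrite (_ : dot v 0 = 0) ?expr0n ?mulr_ge0 ?dotvv_ge0 //.
  by rewrite -(scale0r 0) dotZr mul0r.
have w1 : 0 < dot w w by rewrite lt_neqAle eq_sym w0 dotvv_ge0.
have := dotvv_ge0 (dot w w *: v + (- dot v w) *: w).
rewrite dotDl !dotDr !dotZl !dotZr (dotC w v).
rewrite (_ : _ + _ = dot w w * (dot v v * dot w w - dot v w ^+ 2)); last by ring.
by rewrite pmulr_rge0 // subr_ge0.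
Qed.

Lemma enormD x y : enorm (x + y) <= enorm x + enorm y.
Proof.
rewrite -ler_sqr ?nnegrE ?addr_ge0 ?enorm_ge0 //.
rewrite sqr_enorm dotDl !dotDr (dotC y x) sqrrD !sqr_enorm.
have := le_trans (ler_norm _) (dot_CauchySchwarz x y); lra.
Qed.

Lemma enorm_triangle x y z : enorm (x - z) <= enorm (x - y) + enorm (y - z).
Proof. by have := enormD (x - y) (y - z); rewrite addrA subrK. Qed.

Lemma coord_le_enorm x i : `|x 0 i| <= enorm x.
Proof.
rewrite -ler_sqr ?nnegrE ?enorm_ge0 // real_normK ?num_real // sqr_enorm_sum.
by rewrite (bigD1 i) //= lerDl sumr_ge0 // => j _; rewrite sqr_ge0.
Qed.

Lemma sum_continuous (T : topologicalType) (I : Type) (s : seq I) (F : I -> T -> R) :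
  (forall i, continuous (F i)) -> continuous (fun t => \sum_(i <- s) F i t).
Proof.
move=> cF; elim: s => [|i s IH] t.
  rewrite (_ : (fun t => _) = cst 0); first exact: cvg_cst.
  by apply/funext => u; rewrite big_nil.
rewrite (_ : (fun t => _) = fun t => F i t + \sum_(j <- s) F j t).
  by apply: cvgD; [exact: cF|exact: IH].
by apply/funext => u; rewrite big_cons.
Qed.

Lemma enorm_continuous n : continuous (@enorm R n).
Proof.
move=> x; apply: (continuous_comp (f := fun x : 'rV[R]_n => \sum_i x 0 i ^+ 2)
  (g := Num.sqrt)); last exact: sqrt_continuous.
apply: sum_continuous => i {}x; apply: (continuous_comp (f := fun x : 'rV[R]_n => x 0 i) (g := fun t => t ^+ 2)).
  exact: coord_continuous.
exact: exprn_continuous.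
Qed.

Lemma enormB_continuous p : continuous (fun z : 'rV[R]_3 => enorm (z - p)).
Proof.
move=> z; apply: (@continuous_comp _ _ _ (fun z : 'rV[R]_3 => z - p) (@enorm R 3)).
  by apply: (cvgB cvg_id); exact: cvg_cst.
exact: enorm_continuous.
Qed.

Section Orthogonal.
Variable Q : 'M[R]_3.
Hypothesis QQ : Q *m Q^T = 1%:M.

Let QtQ : Q^T *m Q = 1%:M. Proof. exact: mulmx1C. Qed.

Lemma dot_mulmx v w : dot (v *m Q) (w *m Q) = dot v w.
Proof. by rewrite !dotE trmx_mul mulmxA -(mulmxA v) QQ mulmx1. Qed.

Lemma enorm_mulmxT v : enorm (v *m Q^T) = enorm v.
Proof.
have h : dot (v *m Q^T) (v *m Q^T) = dot v v.
  by rewrite !dotE trmx_mul trmxK mulmxA -(mulmxA v) QtQ mulmx1.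
by apply: (pexpIrn (n := 2)); rewrite ?nnegrE ?enorm_ge0 // !sqr_enorm.
Qed.

Lemma mulmxTK v : v *m Q^T *m Q = v.
Proof. by rewrite -mulmxA QtQ mulmx1. Qed.

Lemma vec3_rotated v :
  vec3 (rotated_coord Q v 0) (rotated_coord Q v 1) (rotated_coord Q v 2%:R) = v *m Q^T.
Proof.
apply/rowP => -[[|[|[|//]]] li]; rewrite mxE /= /rotated_coord; congr (_ _ _);
  exact: val_inj.
Qed.

Lemma rotated_coord_le v i : `|rotated_coord Q v i| <= enorm v.
Proof. by rewrite -enorm_mulmxT; exact: coord_le_enorm. Qed.

Lemma rotated_coordB v w i :
  rotated_coord Q (v - w) i = rotated_coord Q v i - rotated_coord Q w i.
Proof. by rewrite /rotated_coord mulmxBl !mxE. Qed.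

Lemma base_point_square v rho : enorm v <= rho -> square rho (base_point Q v).
Proof. by move=> h; split; apply: le_trans (rotated_coord_le _ _) h. Qed.

Lemma sqr_base_le v : rotated_coord Q v 0 ^+ 2 + rotated_coord Q v 1 ^+ 2 <= enorm v ^+ 2.
Proof.
rewrite -enorm_mulmxT sqr_enorm_sum -vec3_rotated !big_ord_recl big_ord0 addr0 !mxE /=.
by rewrite addrA lerDl sqr_ge0.
Qed.

Lemma rotated_coord_continuous i : continuous (rotated_coord Q ^~ i).
Proof.
move=> v; rewrite /rotated_coord.
rewrite (_ : (fun v : 'rV_3 => _) = fun v : 'rV_3 => \sum_j v 0 j * Q^T j i).
  apply: sum_continuous => j {}v.
  apply: (@cvgM _ _ (nbhs v) _ (fun w : 'rV_3 => w 0 j) (fun=> Q^T j i)).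
    exact: coord_continuous.
  exact: cvg_cst.
by apply/funext => w; rewrite mxE.
Qed.

Lemma base_point_continuous : continuous (base_point Q).
Proof. move=> v.
exact: (cvg_pair (@rotated_coord_continuous 0 v) (@rotated_coord_continuous 1 v)). Qed.

End Orthogonal.
End Euclid.

(** * The normal component of a chord *)

Section Charts.
Variable R : realType.
Variables (Omega : set 'rV[R]_3) (nu : 'rV[R]_3 -> 'rV[R]_3).
Hypotheses (openO : open Omega) (normal_nu : outer_normal Omega nu).
Variables (p : 'rV[R]_3) (r : R) (Q : 'M[R]_3) (g : R * R -> R).
Hypotheses (bp : boundary Omega p) (ch : graph_chart Omega p r Q g).

Let r0 : 0 < r. Proof. by case: ch. Qed.
Let QQ : Q *m Q^T = 1%:M. Proof. by case: ch. Qed.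
Let sg : smooth g. Proof. by case: ch. Qed.

(** A boundary point is not below the graph, since [Omega] is open and does not contain it; it is
    not above, since a neighbourhood above the graph misses [Omega]. *)
Lemma boundary_graph y : boundary Omega y -> enorm (y - p) < r ->
  rotated_coord Q y 2%:R = g (base_point Q y).
Proof.
move=> [cy niy] yr; have [_ _ _ hO] := ch.
have nOy : ~ Omega y by move: niy; rewrite (interior_id _).1.
apply/eqP; rewrite eq_le; apply/andP; split; rewrite leNgt; apply/negP => h; last first.
  by apply: nOy; apply/hO.
pose f z := rotated_coord Q z 2%:R - g (base_point Q z).
have cf : {for y, continuous f}.
  apply: continuousB; first exact: rotated_coord_continuous.
  apply: continuous_comp; first exact: base_point_continuous.
  exact: smooth_continuous.
have n1 : \forall z \near y, 0 < f z.
  by apply: (cvgr_gt _ cf); rewrite subr_gt0.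
have n2 : \forall z \near y, enorm (z - p) < r.
  have ce := @enormB_continuous R p y.
  exact: (cvgr_lt _ ce).
have [z [Oz [fz zr]]] := cy _ (filterI n1 n2).
by move/hO: Oz => /(_ zr); rewrite -subr_lt0 => /(lt_trans fz); rewrite ltxx.
Qed.

Lemma area_density_ge1 u : 1 <= area_density g u.
Proof.
rewrite -[leLHS]sqrtr1 ler_wsqrtr // -addrA lerDl.
by rewrite addr_ge0 // sqr_ge0.
Qed.

(** In the rotated coordinates the chord is (v - u, g v - g u) and the normal is proportional to (-
    grad g u, 1), so their product is a first order Taylor remainder of [g]: this is the source of
    the quadratic bound. *)
Lemma normal_dot x y : boundary Omega x -> boundary Omega y ->
  enorm (x - p) < r -> enorm (y - p) < r ->
  let u := base_point Q y in let v := base_point Q x in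
  dot (nu y) (x - y) = (area_density g u)^-1 *
    (g v - g u - ((v.1 - u.1) * dg1 g u + (v.2 - u.2) * dg2 g u)).
Proof.
move=> bx by_ xr yr u v; rewrite (normal_nu bp ch by_ yr) dotZl; congr (_ * _).
rewrite -[x - y](mulmxTK QQ) dot_mulmx // -vec3_rotated !rotated_coordB.
rewrite !(boundary_graph _ _) //.
by rewrite /dot !big_ord_recl big_ord0 !mxE /=; ring.
Qed.

Lemma nu_enorm y : boundary Omega y -> enorm (y - p) < r -> enorm (nu y) = 1.
Proof.
move=> by_ yr; rewrite (normal_nu bp ch by_ yr) /=.
set u := base_point Q y; have d1 := area_density_ge1 u.
have d0 : 0 < area_density g u by apply: lt_le_trans d1.
rewrite enormZ gtr0_norm ?invr_gt0 //.
suff -> : enorm (vec3 (- dg1 g u) (- dg2 g u) 1 *m Q) = area_density g u.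
  by rewrite mulVf // gt_eqF.
apply: (pexpIrn (n := 2)); rewrite ?nnegrE ?enorm_ge0 ?(ltW d0) //.
rewrite sqr_enorm dot_mulmx // /dot !big_ord_recl big_ord0 !mxE /=.
rewrite sqr_sqrtr; last by rewrite !addr_ge0 ?sqr_ge0.
ring.
Qed.

(** With [y] in the half ball, either |x - y| < r/2 and [x] lies in the same chart, where Taylor's
    formula applies, or |x - y| >= r/2 and |x - y| <= (2/r) |x - y|^2. *)
Lemma chart_kernel_bound : exists M, 0 <= M /\ forall x y,
  boundary Omega x -> boundary Omega y -> enorm (y - p) < r / 2 ->
  `|dot (nu y) (x - y)| <= M * enorm (x - y) ^+ 2.
Proof.
(* Chart coordinates are centred at the origin and not at [p], whence the half side |p| + r. *)
have [M [M0 hM]] := taylor2 (enorm p + r) sg.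
exists (M + 2 / r); split; first by rewrite addr_ge0 // divr_ge0 // ltW.
move=> x y bx by_ yr2.
have yr : enorm (y - p) < r.
  by apply: lt_trans yr2 _; rewrite ltr_pdivrMr // ltr_pMr // ltr1n.
have [xyr|xyr] := ltP (enorm (x - y)) (r / 2); last first.
  apply: le_trans (dot_CauchySchwarz _ _) _; rewrite (nu_enorm by_ yr) mul1r.
  apply: (@le_trans _ _ ((2 / r) * enorm (x - y) ^+ 2)); last first.
    by rewrite ler_wpM2r ?sqr_ge0 // lerDr.
  rewrite expr2 mulrA ler_peMl ?enorm_ge0 //.
  by rewrite mulrAC ler_pdivlMr // mul1r mulrC -ler_pdivrMr.
have xr : enorm (x - p) < r.
  by apply: le_lt_trans (enorm_triangle _ y _) _; rewrite [r]splitr ltrD.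
have sq z : enorm (z - p) < r -> square (enorm p + r) (base_point Q z).
  move=> zr; apply: base_point_square => //.
  rewrite -[z](subrK p) addrC; apply: le_trans (enormD _ _) _.
  by rewrite addrC lerD2l ltW || rewrite lerD2l ltW.
rewrite normal_dot // normrM.
set u := base_point Q y; set v := base_point Q x.
apply: (@le_trans _ _ (M * ((v.1 - u.1) ^+ 2 + (v.2 - u.2) ^+ 2))).
  apply: le_trans (hM u v (sq _ yr) (sq _ xr)).
  have d1 := area_density_ge1 u.
  have d0 : 0 < area_density g u by apply: lt_le_trans d1.
  by rewrite ler_piMl // gtr0_norm ?invr_gt0 // invf_le1.
apply: (@le_trans _ _ (M * enorm (x - y) ^+ 2)).
  rewrite ler_wpM2l // /u /v /base_point /= -!rotated_coordB.
  exact: sqr_base_le.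
by rewrite ler_wpM2r ?sqr_ge0 // lerDl divr_ge0 // ltW.
Qed.

End Charts.

(** The comparison is made on the simple functions below the integrand; in the application [D] is a
    preimage under a graph map, enclosed in a rectangle [B]. *)
Lemma integral_le_cst d (T : measurableType d) (R : realType)
    (mu : {measure set T -> \bar R}) (D B : set T) (f : T -> \bar R) (M : R) :
  0 <= M -> measurable B -> (forall x, D x -> [/\ B x, 0 <= f x & f x <= M%:E]%E) ->
  (\int[mu]_(x in D) f x <= M%:E * mu B)%E.
Proof.
move=> M0 mB h; rewrite -integral_cst //.
rewrite !ge0_integralE; last 2 first.
- by move=> x _; rewrite lee_fin.
- by move=> x hx; case: (h x hx).
apply: ereal_sup_le => _ [s /= hs <-]; exists s => // x.
apply: le_trans (hs x) _; rewrite !patchE; case: ifPn => [|_].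
  by rewrite inE => hx; case: (h x hx) => Bx _ fM; rewrite mem_set.
by case: ifP => // _; rewrite lee_fin.
Qed.

(** * Borel measurability in space *)

Section Borel.
Variable R : realType.
Local Notation X := (borel3 R).

Lemma open_measurable3 (A : set 'rV[R]_3) : open A -> measurable (A : set X).
Proof. by move=> oA; apply: sub_sigma_algebra. Qed.

Lemma closed_measurable3 (A : set 'rV[R]_3) : closed A -> measurable (A : set X).
Proof.
by move=> cA; rewrite -[A]setCK; apply: measurableC; apply: open_measurable3; exact: closed_openC.
Qed.

Lemma continuous_measurable3 (f : 'rV[R]_3 -> R) : continuous f ->
  measurable_fun setT (f : X -> R).
Proof.
move=> cf; apply: (measurability _ (RGenOInfty.measurableE R)) => //.
move=> _ [_ [a ->] <-]; rewrite setTI; apply: open_measurable3.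
by apply: open_comp => //; exact: interval_open.
Qed.

Definition dist3 (x y : X) : R := enorm ((x : 'rV[R]_3) - y).

Lemma measurable_coord3 i : measurable_fun setT (fun x : X => (x : 'rV[R]_3) 0 i).
Proof. by apply: continuous_measurable3 => x; exact: coord_continuous. Qed.

(** Joint measurability refers to the product of the two sigma-algebras, so it is built from
    coordinates and projections. *)
Lemma mkernel_diff i : mkernel (fun x y : X => ((x : 'rV[R]_3) - y) 0 i).
Proof.
rewrite /mkernel; under eq_fun do rewrite !mxE.
apply: measurable_funB.
  exact: (measurableT_comp (measurable_coord3 i) (@measurable_fst _ _ X X)).
exact: (measurableT_comp (measurable_coord3 i) (@measurable_snd _ _ X X)).
Qed.

Lemma mkernel_dist3 : mkernel dist3.
Proof.
rewrite /mkernel /dist3 /enorm.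
apply: (measurableT_comp (f := @Num.sqrt R)); first by apply: continuous_measurable_fun; exact: sqrt_continuous.
by apply: measurable_sum => i; apply: measurable_funX; exact: mkernel_diff.
Qed.

End Borel.

(** * Compactness of the boundary and surface measure in one chart *)

Section Boundary.
Variable R : realType.
Local Notation X := (borel3 R).
Variables (Omega : set 'rV[R]_3) (nu : 'rV[R]_3 -> 'rV[R]_3).
Variable sigma : {measure set X -> \bar R}.
Hypotheses (openO : open Omega) (bndO : bounded_set Omega)
  (smoothO : smooth_boundary Omega) (normal_nu : outer_normal Omega nu)
  (surface_sigma : surface_measure Omega sigma).

Local Notation D := (boundary Omega).

Lemma boundary_closed : closed D.
Proof.
apply: closedI; first exact: closed_closure.
by apply: open_closedC; exact: open_interior.
Qed.

Lemma boundary_measurable : measurable (D : set X).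
Proof. by apply: closed_measurable3; exact: boundary_closed. Qed.

Lemma boundary_compact : compact D.
Proof.
apply: bounded_closed_compact boundary_closed.
have [M [Mr hM]] := bndO; exists M; split=> // y My x [cx _].
have cl : closed [set z : 'rV[R]_3 | `|z| <= y].
  by apply: (@closed_comp _ _ (fun z : 'rV[R]_3 => `|z|) [set t : R | t <= y]) => [z _|]; [exact: norm_continuous|exact: closed_le].
have /closure_id -> := cl.
by apply: closureS cx => z; exact: hM.
Qed.

Definition eball (p : 'rV[R]_3) r : set X := [set z : 'rV[R]_3 | enorm (z - p) < r].

Lemma open_eball (p : 'rV[R]_3) r : open (eball p r : set 'rV[R]_3).
Proof.
apply: (@open_comp _ _ (fun z : 'rV[R]_3 => enorm (z - p)) [set t : R | t < r]) => [z _|].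
  exact: enormB_continuous.
exact: open_lt.
Qed.

Lemma eball_measurable (p : 'rV[R]_3) r : measurable (eball p r).
Proof. by apply: open_measurable3; exact: open_eball. Qed.

(** Compactness is applied to balls of half the chart radius, because [chart_kernel_bound] needs [y]
    there. *)
Lemma finite_atlas : exists (L : seq 'rV[R]_3)
   (c : 'rV[R]_3 -> R * 'M[R]_3 * (R * R -> R)),
  (forall p, p \in L -> D p /\ graph_chart Omega p (c p).1.1 (c p).1.2 (c p).2) /\
  (forall y, D y -> exists2 p, p \in L & enorm (y - p) < (c p).1.1 / 2).
Proof.
have [c hc] : exists c : 'rV[R]_3 -> R * 'M[R]_3 * (R * R -> R), forall p, D p ->
    graph_chart Omega p (c p).1.1 (c p).1.2 (c p).2.
  have h p : exists c : R * 'M[R]_3 * (R * R -> R), D p ->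
      graph_chart Omega p c.1.1 c.1.2 c.2.
    have [Dp|nDp] := pselect (D p); last by exists (0, 0, fun=> 0).
    by have [r [Q [g hg]]] := smoothO Dp; exists (r, Q, g).
  by exists (fun p => projT1 (cid (h p))) => p; exact: (projT2 (cid (h p))).
have := boundary_compact; rewrite compact_cover.
move=> /(_ _ D (fun p => eball p ((c p).1.1 / 2))).
case=> [p _||L LD cov]; first exact: open_eball.
  move=> y Dy; exists y => //=.
  have [r0 _ _ _] := hc y Dy.
  by rewrite /eball /= subrr (_ : enorm 0 = 0) ?divr_gt0 //; apply/eqP; rewrite enorm_eq0.
exists L, c; split => [p pL|y /cov[p /= pL hp]]; last by exists p.
have Dp : D p by have := LD p pL; rewrite inE.
by split => //; exact: hc.
Qed.

Section OneChart.
Variables (p : 'rV[R]_3) (r : R) (Q : 'M[R]_3) (g : R * R -> R).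
Hypotheses (Dp : D p) (ch : graph_chart Omega p r Q g).

Let r0 : 0 < r. Proof. by case: ch. Qed.
Let QQ : Q *m Q^T = 1%:M. Proof. by case: ch. Qed.
Let sg : smooth g. Proof. by case: ch. Qed.

Lemma base_graph_map u : base_point Q (graph_map Q g u) = u.
Proof.
rewrite /base_point /rotated_coord /graph_map -mulmxA QQ mulmx1 !mxE /=.
by case: u.
Qed.

(** The piece of the surface in a ball of radius rho projects into a square of side 2 rho, and the
    area density is at most M = 1 + M1 + M2 there, whence 4 M rho^2. The centre [x] need not lie on
    the surface. *)
Lemma chart_growth : exists2 C : R, 0 <= C & forall (x : 'rV[R]_3) (rho : R), 0 < rho ->
  (sigma (D `&` eball p r `&` eball x rho) <=
   (C * rho ^+ 2)%:E)%E.
Proof.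
have [s1 s2] := smooth_dg sg.
have [M1 [M10 hM1]] := continuous_square_bounded (enorm p + r) (smooth_continuous s1).
have [M2 [M20 hM2]] := continuous_square_bounded (enorm p + r) (smooth_continuous s2).
pose M := 1 + M1 + M2.
have M0 : 0 <= M by rewrite !addr_ge0.
exists (4 * M); first by rewrite mulr_ge0.
move=> x rho rho0; set A := _ `&` _ `&` _.
have mA : measurable (A : set X).
  apply: measurableI; first by apply: measurableI; [exact: boundary_measurable|exact: eball_measurable].
  exact: eball_measurable.
have [_ h] := surface_sigma.
rewrite (h p r Q g Dp ch A mA); first last.
- by move=> y [[]].
- by move=> y [[]].
set a := rotated_coord Q x 0; set b := rotated_coord Q x 1.
pose B : set (R * R) := `]a - rho, a + rho[%classic `*` `]b - rho, b + rho[%classic.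
have mB : measurable B by apply: measurableX; exact: measurable_itv.
apply: (@le_trans _ _ (M%:E * (lebesgue_measure \x lebesgue_measure)%E B)%E).
  apply: integral_le_cst => // u [[Dy yr] yx].
  set y := graph_map Q g u in Dy yr yx.
  have uE : u = base_point Q y by rewrite base_graph_map.
  have ur : square (enorm p + r) u.
    rewrite uE; apply: base_point_square => //.
    rewrite -[y](subrK p); apply: le_trans (enormD _ _) _.
    by rewrite addrC lerD2l ltW.
  have coordle i : `|rotated_coord Q x i - rotated_coord Q y i| < rho.
    by rewrite -rotated_coordB; rewrite /eball /= enormBC in yx; apply: le_lt_trans yx; exact: rotated_coord_le.
  split.
  - split; rewrite /= in_itv /= uE /= -ltr_distlC; exact: coordle.
  - by rewrite lee_fin sqrtr_ge0.
  - rewrite lee_fin /area_density.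
    have h1 := hM1 u ur; have h2 := hM2 u ur.
    rewrite -[leRHS]ger0_norm // -sqrtr_sqr ler_wsqrtr //.
    rewrite -[dg1 g u ^+ 2]real_normK ?num_real // -[dg2 g u ^+ 2]real_normK ?num_real //.
    have q1 : `|dg1 g u| ^+ 2 <= M1 ^+ 2 by rewrite lerXn2r ?nnegrE.
    have q2 : `|dg2 g u| ^+ 2 <= M2 ^+ 2 by rewrite lerXn2r ?nnegrE.
    apply: (@le_trans _ _ (1 + M1 ^+ 2 + M2 ^+ 2)); first by rewrite !lerD.
    have m12 : 0 <= M1 * M2 by rewrite mulr_ge0.
    have -> : M ^+ 2 = 1 + M1 ^+ 2 + M2 ^+ 2 + 2 * (M1 + M2 + M1 * M2) by rewrite /M; ring.
    by rewrite lerDl mulr_ge0 // !addr_ge0.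
have -> : (lebesgue_measure \x lebesgue_measure)%E B = ((2 * rho) * (2 * rho))%:E.
  pose I1 : set R := `]a - rho, a + rho[%classic.
  pose I2 : set R := `]b - rho, b + rho[%classic.
  transitivity (@lebesgue_measure R I1 * @lebesgue_measure R I2)%E.
    by apply: product_measure1E; exact: measurable_itv.
  rewrite /I1 /I2 !lebesgue_measure_itv /= !lte_fin !ltrBlDr -!addrA !ltrDl !addr_gt0 //.
  by rewrite -!EFinD -!EFinM; congr _%:E; ring.
by rewrite -EFinM lee_fin le_eqVlt; apply/orP; left; apply/eqP; ring.
Qed.

Lemma chart_nu_measurable i :
  measurable_fun ((D : set X) `&` eball p r)
    (fun y : X => nu y 0 i).
Proof.
have [s1 s2] := smooth_dg sg.
have cb (f : R * R -> R) : continuous f -> measurable_fun setT (fun y : X => f (base_point Q y)).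
  move=> cf; apply: continuous_measurable3 => y.
  apply: continuous_comp; first exact: base_point_continuous.
  exact: cf.
have m1 := cb _ (smooth_continuous s1); have m2 := cb _ (smooth_continuous s2).
pose v (y : X) := vec3 (- dg1 g (base_point Q y)) (- dg2 g (base_point Q y)) 1.
have mv j : measurable_fun setT (fun y => v y 0 j).
  case: j => -[|[|[|//]]] lj; rewrite /v.
  - rewrite (_ : (fun y => _) = fun y => - dg1 g (base_point Q y)).
      exact: measurable_funN.
    by apply/funext => y; rewrite mxE.
  - rewrite (_ : (fun y => _) = fun y => - dg2 g (base_point Q y)).
      exact: measurable_funN.
    by apply/funext => y; rewrite mxE.
  - rewrite (_ : (fun y => _) = cst 1); first exact: measurable_cst.
    by apply/funext => y; rewrite mxE.
have md : measurable_fun setT (fun y : X => (area_density g (base_point Q y))^-1).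
  apply: measurable_funV.
  apply: (measurableT_comp (f := @Num.sqrt R)); first by apply: continuous_measurable_fun; exact: sqrt_continuous.
  apply: measurable_funD; last exact: measurable_funX.
  by apply: measurable_funD => //; exact: measurable_funX.
apply: (@eq_measurable_fun _ _ _ _ _ (fun y : X => (area_density g (base_point Q y))^-1 *
   \sum_j v y 0 j * Q j i)).
  by move=> y; rewrite inE => -[Dy yr]; rewrite (normal_nu Dp ch Dy yr) /= !mxE.
apply: measurable_funTS; apply: measurable_funM => //.
by apply: measurable_sum => j; exact: measurable_funM.
Qed.

End OneChart.
End Boundary.

(** * From charts to the whole boundary *)

Section Atlas.
Variable R : realType.
Local Notation X := (borel3 R).
Variables (Omega : set 'rV[R]_3) (nu : 'rV[R]_3 -> 'rV[R]_3).
Variable sigma : {measure set X -> \bar R}.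
Hypotheses (openO : open Omega) (bndO : bounded_set Omega)
  (smoothO : smooth_boundary Omega) (normal_nu : outer_normal Omega nu)
  (surface_sigma : surface_measure Omega sigma).

Local Notation D := (boundary Omega).

Definition atlas (L : seq 'rV[R]_3) (c : 'rV[R]_3 -> R * 'M[R]_3 * (R * R -> R)) :=
  forall p, p \in L -> D p /\ graph_chart Omega p (c p).1.1 (c p).1.2 (c p).2.

Definition chart_union (L : seq 'rV[R]_3) (c : 'rV[R]_3 -> R * 'M[R]_3 * (R * R -> R)) : set X :=
  [set y | exists2 p, p \in L & eball p (c p).1.1 y].

Lemma chart_union_cons q L c : chart_union (q :: L) c = eball q (c q).1.1 `|` chart_union L c.
Proof.
apply/seteqP; split => y.
  move=> [p]; rewrite inE => /orP[/eqP->|pL] h; first by left.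
  by right; exists p.
by move=> [h|[p pL h]]; [exists q; rewrite ?mem_head|exists p; rewrite // inE pL orbT].
Qed.

Lemma chart_union_measurable L c : measurable (chart_union L c).
Proof.
elim: L => [|q L IH].
  rewrite (_ : chart_union _ _ = set0) //.
  by apply/seteqP; split => y // [p].
by rewrite chart_union_cons; apply: measurableU => //; exact: eball_measurable.
Qed.

Lemma union_growth L c : atlas L c -> exists2 C : R, 0 <= C &
  forall (x : 'rV[R]_3) (rho : R), 0 < rho ->
  (sigma ((D : set X) `&` chart_union L c `&` eball x rho) <= (C * rho ^+ 2)%:E)%E.
Proof.
elim: L => [|q L IH] aL.
  exists 0 => // x rho _; rewrite mul0r.
  rewrite (_ : _ `&` _ = set0) ?measure0 //.
  by apply/seteqP; split => y // [[_ [p]]].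
have [p pL|C C0 hC] := IH; first by apply: aL; rewrite inE pL orbT.
have [Dq chq] := aL q (mem_head q L).
have [C' C'0 hC'] := chart_growth surface_sigma Dq chq.
exists (C' + C) => [|x rho rho0]; first by rewrite addr_ge0.
rewrite chart_union_cons setIUr setIUl.
have mD := boundary_measurable Omega.
have m1 : measurable ((D : set X) `&` eball q (c q).1.1 `&` eball x rho).
  by apply: measurableI; [apply: measurableI => //|]; exact: eball_measurable.
have m2 : measurable ((D : set X) `&` chart_union L c `&` eball x rho).
  apply: measurableI; last exact: eball_measurable.
  by apply: measurableI => //; exact: chart_union_measurable.
apply: le_trans (measureU2 sigma m1 m2) _.
by rewrite mulrDl EFinD; apply: leeD; [exact: hC'|exact: hC].
Qed.

Lemma union_nu_measurable L c i : atlas L c ->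
  measurable_fun ((D : set X) `&` chart_union L c) (fun y : X => nu y 0 i).
Proof.
elim: L => [|q L IH] aL.
  rewrite (_ : _ `&` _ = set0); first exact: measurable_fun_set0.
  by apply/seteqP; split => y // [_ [p]].
have [Dq chq] := aL q (mem_head q L).
have mD := boundary_measurable Omega.
rewrite chart_union_cons setIUr; apply/measurable_funU.
- by apply: measurableI => //; exact: eball_measurable.
- by apply: measurableI => //; exact: chart_union_measurable.
split; first exact: (chart_nu_measurable normal_nu Dq chq).
by apply: IH => p pL; apply: aL; rewrite inE pL orbT.
Qed.

Lemma union_kernel_bound L c : atlas L c -> exists2 M : R, 0 <= M &
  forall x y, D x -> D y ->
   (exists2 p, p \in L & enorm (y - p) < (c p).1.1 / 2) ->
   `|dot (nu y) (x - y)| <= M * enorm (x - y) ^+ 2.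
Proof.
elim: L => [|q L IH] aL; first by exists 0 => // x y _ _ [p].
have [p pL|M M0 hM] := IH; first by apply: aL; rewrite inE pL orbT.
have [Dq chq] := aL q (mem_head q L).
have [M' [M'0 hM']] := chart_kernel_bound openO normal_nu Dq chq.
exists (M' + M) => [|x y Dx Dy [p]]; first by rewrite addr_ge0.
rewrite inE => /orP[/eqP->|pL] h.
  apply: le_trans (hM' x y Dx Dy h) _.
  by rewrite ler_wpM2r ?sqr_ge0 // lerDl.
apply: (@le_trans _ _ (M * enorm (x - y) ^+ 2)); first by apply: hM => //; exists p.
by rewrite ler_wpM2r ?sqr_ge0 // lerDr.
Qed.

Lemma boundary_sub_union L c : atlas L c ->
  (forall y, D y -> exists2 p, p \in L & enorm (y - p) < (c p).1.1 / 2) ->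
  (D : set X) `<=` chart_union L c.
Proof.
move=> aL cov y /cov[p pL h]; exists p => //; apply: lt_trans h _.
have [_ [r0 _ _ _]] := aL p pL.
by rewrite ltr_pdivrMr // ltr_pMr // ltr1n.
Qed.

Lemma rball_eball x rho : rball (@dist3 R) x rho = eball x rho.
Proof. by apply/seteqP; split => y; rewrite /rball /eball /dist3 /= enormBC. Qed.

(** The part of the ball off the boundary has measure 0, so the chart estimates extend to balls of
    the whole space; C + 1 only makes the constant positive. *)
Lemma boundary_growth : exists2 C : R, 0 < C &
  forall x rho, 0 < rho -> (sigma (rball (@dist3 R) x rho) <= (C * rho ^+ 2)%:E)%E.
Proof.
have [L [c [aL cov]]] := finite_atlas bndO smoothO.
have [C C0 hC] := union_growth aL.
have sub := boundary_sub_union aL cov.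
exists (C + 1) => [|x rho rho0]; first by rewrite ltr_wpDl.
rewrite rball_eball.
have mD := boundary_measurable Omega.
have mB := eball_measurable x rho.
have -> : eball x rho = ((D : set X) `&` eball x rho) `|` (~` (D : set X) `&` eball x rho).
  by rewrite -setIUl setUv setTI.
have m1 : measurable ((D : set X) `&` eball x rho) by exact: measurableI.
have m2 : measurable (~` (D : set X) `&` eball x rho).
  by apply: measurableI => //; exact: measurableC.
apply: le_trans (measureU2 sigma m1 m2) _.
have [s0 _] := surface_sigma.
rewrite (@subset_measure0 _ _ _ sigma (~` (D : set X) `&` eball x rho) (~` (D : set X))) //;
  last exact: measurableC.
rewrite adde0; apply: (@le_trans _ _ (C * rho ^+ 2)%:E).
  rewrite -[X in X `&` _](setIidl sub); exact: hC.
by rewrite lee_fin ler_wpM2r ?sqr_ge0 // lerDl.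
Qed.

(** The boundary is bounded, so one ball carries all the mass and the growth estimate applies to
    it. *)
Lemma surface_finite : (sigma setT < +oo)%E.
Proof.
have [C C0 hC] := boundary_growth.
have [M [_ hM]] := compact_bounded (continuous_compact (continuous_subspaceT (@enorm_continuous R 3))
  (boundary_compact bndO)).
pose rho := `|M| + 2.
have rho0 : 0 < rho by rewrite ltr_wpDl.
have sub : [set: X] `<=` ~` (D : set X) `|` rball (@dist3 R) (0 : 'rV_3) rho.
  move=> y _; have [Dy|nDy] := pselect (D y); [right|by left].
  rewrite /rball /dist3 /= enormBC subr0.
  have h : `|enorm y| <= `|M| + 1.
    by apply: hM; [rewrite (le_lt_trans (ler_norm _)) // ltrDl|exists y].
  rewrite ger0_norm ?enorm_ge0 // in h; apply: le_lt_trans h _.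
  by rewrite /rho ltrD2l ltr1n.
have mD := boundary_measurable Omega.
have mB : measurable (rball (@dist3 R) (0 : 'rV_3) rho).
  by rewrite rball_eball; exact: eball_measurable.
have m2 := measurableC mD.
apply: (@le_lt_trans _ _ (sigma (~` (D : set X) `|` rball (@dist3 R) (0 : 'rV_3) rho))).
  by apply: le_measure; rewrite ?inE //; exact: measurableU.
apply: le_lt_trans (measureU2 sigma m2 mB) _.
have [s0 _] := surface_sigma.
rewrite [X in (X + _)%E]s0 add0e.
exact: le_lt_trans (hC _ _ rho0) (ltry _).
Qed.

End Atlas.

(** * The double layer kernel *)

Section FiniteCopy.
Context d (X : measurableType d) (R : realType).
Variables (sigma : {measure set X -> \bar R}) (fin : (sigma setT < +oo)%E).

(** The finiteness proof is an argument, so that the structure of a finite measure can be attached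
    to this copy. *)
Definition finite_copy of (sigma setT < +oo)%E : set X -> \bar R := sigma.
Let copy := finite_copy fin.
Let copy_fin : fin_num_fun copy. Proof. exact: lty_fin_num_fun. Qed.
HB.instance Definition _ := Measure.on copy.
HB.instance Definition _ := Measure_isFinite.Build _ X R copy copy_fin.

End FiniteCopy.

Lemma finite_measure_exists d (X : measurableType d) (R : realType)
    (sigma : {measure set X -> \bar R}) : (sigma setT < +oo)%E ->
  exists mu : {finite_measure set X -> \bar R}, (mu : {measure set X -> \bar R}) = sigma.
Proof.
move=> fin; exists (finite_copy fin : {finite_measure set X -> \bar R}).
by case: sigma fin => f [a b] fin.
Qed.

Section Kernel.
Variable R : realType.
Local Notation X := (borel3 R).
Variables (Omega : set 'rV[R]_3) (nu : 'rV[R]_3 -> 'rV[R]_3).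
Local Notation D := (boundary Omega).

(** [nu] is prescribed on the boundary only; extension by 0 makes it measurable everywhere. *)
Definition boundary_normal i : X -> R := (fun y : X => nu y 0 i) \_ D.

(** The normal derivative written out, and 0 as soon as one variable leaves the boundary:
    measurability and the bound M/|x - y| then hold for all pairs of points of space. *)
Definition double_layer_kernel (x y : X) : R := \1_D x *
  ((2 * pi)^-1 * ((\sum_i boundary_normal i y * ((x : 'rV[R]_3) - y) 0 i) * (dist3 x y)^-1 ^+ 3)).

Lemma double_layer_kernelE x y : D x -> D y -> double_layer_kernel x y = 'D_(nu y) (newton x) y.
Proof.
move=> Dx Dy; rewrite /double_layer_kernel indicE mem_set // mul1r derive_newton; congr (_ * _).
rewrite exprVn; congr (_ / _); apply: eq_bigr => i _.
by rewrite /boundary_normal patchE mem_set.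
Qed.

Lemma double_layer_kernel0l x y : ~ D x -> double_layer_kernel x y = 0.
Proof. by move=> nDx; rewrite /double_layer_kernel indicE memNset // mul0r. Qed.

Lemma double_layer_kernel0r x y : ~ D y -> double_layer_kernel x y = 0.
Proof.
move=> nDy; rewrite /double_layer_kernel big1 ?mul0r ?mulr0 // => i _.
by rewrite /boundary_normal patchE memNset // mul0r.
Qed.

Hypotheses (openO : open Omega) (bndO : bounded_set Omega)
  (smoothO : smooth_boundary Omega) (normal_nu : outer_normal Omega nu).

Lemma mkernel_double_layer : mkernel double_layer_kernel.
Proof.
have [L [c [aL cov]]] := finite_atlas bndO smoothO.
have mnu i : measurable_fun setT (boundary_normal i).
  apply/(measurable_restrictT _ (boundary_measurable Omega)).
  have := union_nu_measurable normal_nu i aL.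
  by rewrite setIidl //; exact: boundary_sub_union.
apply: measurable_funM.
  apply: (measurableT_comp (f := \1_D : X -> R)); last exact: measurable_fst.
  by apply: measurable_indic; exact: boundary_measurable.
apply: measurable_funM => //; apply: measurable_funM.
  apply: measurable_sum => i; apply: measurable_funM; last exact: mkernel_diff.
  by apply: (measurableT_comp (mnu i)); exact: measurable_snd.
by apply: measurable_funX; apply: measurable_funV; exact: mkernel_dist3.
Qed.

Lemma double_layer_kernel_bound : exists2 M : R, 0 < M & forall x y, `|double_layer_kernel x y| <= M * (dist3 x y)^-1.
Proof.
have [L [c [aL cov]]] := finite_atlas bndO smoothO.
have [M M0 hM] := union_kernel_bound openO normal_nu aL.
have p0 : 0 < (2 * pi : R)^-1 by rewrite invr_gt0 mulr_gt0 // pi_gt0.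
exists ((2 * pi)^-1 * (M + 1)) => [|x y]; first by rewrite mulr_gt0 // ltr_wpDl.
have e0 : 0 <= dist3 x y by exact: enorm_ge0.
have r0 : 0 <= (2 * pi)^-1 * (M + 1) * (dist3 x y)^-1.
  by rewrite !mulr_ge0 ?(ltW p0) ?invr_ge0 // addr_ge0.
have [Dx|nDx] := pselect (D x); last by rewrite double_layer_kernel0l // normr0.
have [Dy|nDy] := pselect (D y); last by rewrite double_layer_kernel0r // normr0.
rewrite double_layer_kernelE // derive_newton normrM (gtr0_norm p0) -mulrA ler_wpM2l ?(ltW p0) //.
rewrite normrM normfV normrX (ger0_norm (enorm_ge0 _)).
have [d0|d0] := eqVneq (dist3 x y) 0.
  by rewrite -/(dist3 x y) d0 expr0n /= invr0 !mulr0.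
have h := hM x y Dx Dy (cov y Dy).
have {}d0 : 0 < dist3 x y by rewrite lt_neqAle eq_sym d0.
rewrite -/(dist3 x y) ler_pdivrMr ?exprn_gt0 //.
apply: le_trans h _; rewrite -/(dist3 x y).
rewrite [X in _ <= X](_ : _ = (M + 1) * dist3 x y ^+ 2).
  by rewrite ler_wpM2r ?sqr_ge0 // lerDl.
by field; rewrite gt_eqF.
Qed.

Variable mu : {finite_measure set X -> \bar R}.

Lemma double_layerE (f g : X -> R[i]) x : {in (D : set X), f =1 g} -> D x ->
  double_layer Omega nu mu f x = ckernel_op mu double_layer_kernel g x.
Proof.
move=> fg Dx; rewrite /double_layer /cintegral /ckernel_op /kernel_op.
have key (h h' : X -> R) : (forall y, D y -> h y = h' y * double_layer_kernel x y) ->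
    \int[mu]_(y in D) h y = \int[mu]_y (h' y * double_layer_kernel x y).
  move=> hh; rewrite Rintegral_mkcond; apply: eq_Rintegral => y _.
  rewrite patchE; case: ifPn => [|]; first by rewrite inE => /hh.
  by rewrite notin_setE => nDy; rewrite double_layer_kernel0r // mulr0.
congr (_ +i* _); apply: key => y Dy.
  rewrite double_layer_kernelE // fg ?inE //; case: (g y) => a b /=.
  by rewrite mulr0 subr0.
rewrite double_layer_kernelE // fg ?inE //; case: (g y) => a b /=.
by rewrite mulr0 add0r.
Qed.

(** Off the boundary the two operators may differ. Agreement on the boundary passes through each
    iteration because both integrate over the boundary only. *)
Lemma iter_double_layerE (f : X -> R[i]) z n :
  {in (D : set X), iter n (fun phi x => double_layer Omega nu mu phi x - z * phi x) f =1
   iter n (fun phi x => ckernel_op mu double_layer_kernel phi x - z * phi x) f}.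
Proof.
elim: n => [//|n IH] x xD /=.
have Dx : D x by rewrite inE in xD.
by rewrite (double_layerE IH Dx) IH.
Qed.

End Kernel.

(** * Eigenvalue asymptotics *)

Lemma sum_count_undup (T : eqType) (t : seq T) :
  (\sum_(z <- undup t) count_mem z t = size t)%N.
Proof.
rewrite -sum1_size -[RHS]big_undup_iterop_count /=; apply: eq_bigr => z _.
by rewrite Monoid.iteropE /= iter_addn addn0 mul1n.
Qed.

Lemma norm_complexE (R : rcfType) (z : R[i]) : `|z| = (complex.Re `|z|)%:C.
Proof.
have := normr_ge0 z; case: `|z| => a b /=.
by rewrite lecE /= => /andP[/eqP-> _].
Qed.

Section EigenvalueCount.
Context d (X : measurableType d) (R : realType).
Variable mu : {finite_measure set X -> \bar R}.
Variables (k : X -> X -> R) (B : R).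
Hypotheses (B0 : 0 < B) (kB : schur mu k B).
Variables (T : (X -> R[i]) -> X -> R[i]) (D : set X).
Hypotheses (aeD : {ae mu, forall x, D x})
  (TE : forall f z n, {in D,
     iter n (fun phi x => T phi x - z * phi x) f =1
     iter n (fun phi x => ckernel_op mu k phi x - z * phi x) f}).

Local Notation ip := (@L2ip _ _ _ mu).
Local Notation K := (L2op B0 kB).

Lemma L2val_sum I (r : seq I) (a : I -> R[i]) (f : I -> L2fun mu) x :
  (\sum_(i <- r) a i *: f i : L2fun mu) x = \sum_(i <- r) a i * f i x.
Proof.
elim: r => [|i r IH]; first by rewrite !big_nil.
by rewrite !big_cons L2val_lin IH.
Qed.

Lemma gen_eigen_L2op z psi (h : L2 mu psi) : generalized_eigenvector mu T z psi ->
  gen_eigen ip K z (MkL2fun (asboolT h)).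
Proof.
move=> [_ [n hn]]; apply/gen_eigenE; exists n.
apply: filterS2 aeD hn => x Dx.
by rewrite TE ?inE.
Qed.

Lemma multiplicity_basis z m : multiplicity_ge mu T z m ->
  exists phi : nat -> L2fun mu,
    (forall i, (i < m)%N -> gen_eigen ip K z (phi i)) /\
    (forall a : nat -> R[i], nullv ip (\sum_(i < m) a i *: phi i) ->
       forall i, (i < m)%N -> a i = 0).
Proof.
move=> [psi [hpsi free]].
have h j : L2 mu (psi j) by have [] := hpsi j.
pose phi i := if insub i is Some j then MkL2fun (asboolT (h j)) else 0.
have phiE (j : 'I_m) : phi j = MkL2fun (asboolT (h j)).
  by rewrite /phi valK.
exists phi; split=> [i li|a a0 i li].
  by rewrite (phiE (Ordinal li)); exact: gen_eigen_L2op.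
apply: (free (fun j => a j) _ (Ordinal li)).
move/nullv_ae: a0; apply: filterS => x.
by rewrite L2val_sum; under eq_bigr do rewrite phiE.
Qed.

Variable lam : nat -> R[i].
Hypothesis ordered : ordered_eigenvalues mu T lam.

(** For each distinct value z among lambda_0, ..., lambda_n, as many independent generalized
    eigenvectors are taken as z has occurrences, n + 1 in all. The diagonal of the flag consists of
    such values, of modulus at least |lambda_n| by the ordering. *)
Lemma eigenvalue_flag n : exists N e c, [/\ flag ip K N e c, (n < N)%N &
  forall i, (i < N)%N -> `|lam n| <= `|c i|].
Proof.
have [decr mul _] := ordered.
pose t := mkseq lam n.+1.
have /choice[phi hphi] : forall z, exists phi : nat -> L2fun mu,
    (forall i, (i < count_mem z t)%N -> gen_eigen ip K z (phi i)) /\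
    (forall a : nat -> R[i], nullv ip (\sum_(i < count_mem z t) a i *: phi i) ->
       forall i, (i < count_mem z t)%N -> a i = 0).
  by move=> z; apply: multiplicity_basis; exact: mul.
pose L := [seq (z, phi z i) | z <- undup t, i <- iota 0 (count_mem z t)].
have si := L2ip_semi_inner mu.
have Tl := L2op_ae_linear B0 kB.
have [p|N [e [c [fl Dc sp]]]] := @flag_extend_seq _ _ _ si _ Tl (fun z => `|lam n| <= `|z|) L.
  case/allpairsPdep => z [i [zt]]; rewrite mem_iota add0n => /= li ->; split => /=.
    move: zt; rewrite mem_undup => /mapP[j]; rewrite mem_iota add0n => /= jn ->.
    by apply: decr; rewrite -ltnS.
  by have [h _] := hphi z; exact: h.
exists N, e, c; split => //.
have <- : size t = n.+1 by rewrite size_mkseq.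
rewrite -(sum_count_undup t).
apply: (flag_dim_ge si Tl (psi := phi) (undup_uniq t) fl) => [z i zt li|z zt a a0 i li].
  have [h _] := hphi z; split; first exact: h.
  apply: (sp (z, phi z i)); apply/allpairsPdep; exists z, i.
  by rewrite mem_iota add0n.
by have [_ h] := hphi z; exact: (h a).
Qed.

(** The flag gives the inequality with N in place of n + 1. If |lambda_n|^2 <= 2 b^2 the claim is
    immediate; otherwise |lambda_n|^2 - 2 b^2 is positive and N may be lowered to n + 1. *)
Lemma eigenvalue_bound n (kf kn : X -> X -> R) (A b : R) :
  k = (fun x y => kf x y + kn x y) -> mkernel kf -> 0 < b -> schur mu kn b ->
  0 <= A -> (forall x, (\int[mu]_y (kf x y ^+ 2)%:E <= A%:E)%E) ->
  complex.Re `|lam n| ^+ 2 * n.+1%:R <= 2 * A * fine (mu setT) + 2 * b ^+ 2 * n.+1%:R.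
Proof.
move=> kE mkf b0 knb A0 kfA.
have [N [e [c [fl nN lamc]]]] := eigenvalue_flag n.
have si := L2ip_semi_inner mu.
have h1 := diag_le_image si fl.
have h2 : \sum_(i < N) ip (K (e i)) (K (e i)) <=
    (2 * A * fine (mu setT) + 2 * b ^+ 2 * N%:R)%:C.
  (* [K] carries proofs about [k], so these and the flag are generalized before [k] is replaced by
     the sum. *)
  move: kE B0 kB fl => kE; clear -kE mkf b0 knb kfA; subst k => B0 kB [eo _].
  exact: (trace_image_le mkf b0 knb kfA).
have := le_trans h1 h2.
have aE := norm_complexE (lam n); set a := complex.Re `|lam n| in aE *.
have a0 : 0 <= a by rewrite -lecR -aE normr_ge0.
have V0 : 0 <= fine (mu setT) by rewrite fine_ge0.
have h3 : (a ^+ 2 * N%:R)%:C <= \sum_(i < N) `|c i| ^+ 2 :> R[i].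
  rewrite mulr_natr -[N in _ *+ N]card_ord -sumr_const rmorph_sum /=.
  apply: ler_sum => i _; rewrite rmorphXn /= -aE lerXn2r ?nnegrE ?normr_ge0 //.
  exact: lamc.
move=> /(le_trans h3); rewrite lecR => h4.
have nN' : (n.+1%:R : R) <= N%:R by rewrite ler_nat.
have [ab|ab] := leP (a ^+ 2) (2 * b ^+ 2).
  apply: (@le_trans _ _ (2 * b ^+ 2 * n.+1%:R)); first by rewrite ler_wpM2r.
  by rewrite lerDr !mulr_ge0.
rewrite -lerBlDr -mulrBl.
apply: (@le_trans _ _ ((a ^+ 2 - 2 * b ^+ 2) * N%:R)).
  by rewrite ler_wpM2l // subr_ge0 ltW.
by rewrite mulrBl lerBlDr.
Qed.

End EigenvalueCount.

(** The rate is a power of n while m is defined from n + 1; the slack between 2^m and 4^m absorbs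
    the shift. *)
Lemma expn2_le m n : (4 ^ m <= n.+1)%N -> (0 < n)%N -> (2 ^ m <= n)%N.
Proof.
case: m => [|m] l1 n0; first by rewrite expn0.
rewrite -ltnS; apply: leq_trans l1.
have -> : (4 ^ m.+1 = 2 ^ m.+1 * 2 ^ m.+1)%N by rewrite -expnMn.
have : (2 <= 2 ^ m.+1)%N by rewrite -[X in (X <= _)%N]expn1 leq_exp2l.
move: (2 ^ m.+1)%N => q q2; apply: (@leq_trans (2 * q)).
  by rewrite mul2n -addnn -addn1 leq_add2l; apply: leq_trans q2.
by rewrite leq_mul2r q2 orbT.
Qed.

(** * From the logarithmic bound to every power *)

Section Asymptotics.
Variable R : realType.

(** t^delta >= exp(kappa m) with kappa = delta ln 2, and exp(x) = exp(x/2)^2 >= (x/2)^2: a quadratic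
    function of m beats an affine one. [m0] is the point from which eps kappa^2 m / 4 >= P + Q. *)
Lemma affine_le_powR (P Q delta eps : R) : 0 <= P -> 0 <= Q -> 0 < delta -> 0 < eps ->
  exists m0, forall m (t : R), (m0 <= m)%N -> 2 ^+ m <= t -> P + Q * m%:R <= eps * t `^ delta.
Proof.
move=> P0 Q0 d0 e0; pose kappa := delta * ln 2.
have ln20 : 0 < ln (2 : R) by rewrite ln_gt0 // ltr1n.
have k0 : 0 < kappa by rewrite mulr_gt0.
pose m0 := (Num.bound (4 * (P + Q) / (eps * kappa ^+ 2))).+1.
exists m0 => m t mm0 mt.
have t0 : 0 < t by apply: lt_le_trans mt; rewrite exprn_gt0.
have m1 : 1 <= m%:R :> R by rewrite ler1n; apply: leq_trans mm0.
have ek : 0 < eps * kappa ^+ 2 by rewrite mulr_gt0 ?exprn_gt0.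
have hm : 4 * (P + Q) / (eps * kappa ^+ 2) <= m%:R.
  apply: le_trans (ltW (archi_boundP _)) _.
    by rewrite divr_ge0 ?(ltW ek) // mulr_ge0 // addr_ge0.
  by rewrite ler_nat; apply: leq_trans mm0.
rewrite ler_pdivrMr // in hm.
apply: (@le_trans _ _ ((P + Q) * m%:R)).
  by rewrite mulrDl lerD2r ler_peMr.
apply: (@le_trans _ _ (eps * ((kappa * m%:R / 2) ^+ 2))).
  apply: (@le_trans _ _ (m%:R * (eps * kappa ^+ 2) / 4 * m%:R)).
    by rewrite ler_wpM2r // ler_pdivlMr // mulrC.
  by rewrite le_eqVlt; apply/orP; left; apply/eqP; field.
rewrite ler_wpM2l ?(ltW e0) //.
have -> : t `^ delta = expR (delta * ln t) by rewrite /powR gt_eqF.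
apply: (@le_trans _ _ (expR (kappa * m%:R))); last first.
  rewrite ler_expR /kappa -mulrA ler_wpM2l ?(ltW d0) //.
  by rewrite mulr_natr -lnXn // ler_ln ?posrE ?exprn_gt0.
have -> : expR (kappa * m%:R) = expR (kappa * m%:R / 2) ^+ 2.
  by rewrite -expRM_natl -mulr_natl; congr expR; field.
have km : 0 <= kappa * m%:R / 2 by rewrite divr_ge0 // mulr_ge0 // ltW.
rewrite lerXn2r ?nnegrE ?expR_ge0 //.
by apply: le_trans (expR_ge1Dx _); rewrite lerDr.
Qed.

(** After squaring and multiplying by n the target is eps^2 n^(2 alpha + 1), whose exponent is
    positive exactly because alpha > -1/2. *)
Lemma bound_decay (a : nat -> R) (P Q alpha : R) : - 2^-1 < alpha ->
  0 <= P -> 0 <= Q -> (forall n, 0 <= a n) ->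
  (forall n m, (4 ^ m <= n.+1)%N -> (n.+1 < 4 ^ m.+1)%N ->
     a n ^+ 2 * n.+1%:R <= P + Q * m%:R) ->
  forall eps, 0 < eps -> \forall n \near \oo, a n <= eps * n%:R `^ alpha.
Proof.
move=> al P0 Q0 a0 h eps e0.
have d0 : 0 < 2 * alpha + 1 by lra.
have e2 : 0 < eps ^+ 2 by rewrite exprn_gt0.
have [m0 hm0] := affine_le_powR P0 Q0 d0 e2.
exists (4 ^ m0)%N => // n /= hn.
pose m := trunc_log 4 n.+1.
have l1 : (4 ^ m <= n.+1)%N by apply: trunc_logP.
have l2 : (n.+1 < 4 ^ m.+1)%N by apply: trunc_log_ltn.
have mm : (m0 <= m)%N.
  by rewrite -ltnS -(@ltn_exp2l 4) //; apply: leq_ltn_trans l2; exact: leq_trans hn (leqnSn n).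
have n0 : (0 < n)%N by apply: leq_trans hn; rewrite expn_gt0.
have mn : (2 : R) ^+ m <= n%:R.
  rewrite -natrX ler_nat.
  exact: expn2_le.
have nR : 0 < n%:R :> R by rewrite ltr0n.
have hh := le_trans (h n m l1 l2) (hm0 m n%:R mm mn).
rewrite -ler_sqr ?nnegrE ?mulr_ge0 ?powR_ge0 ?(ltW e0) //.
rewrite exprMn -(ler_pM2r nR).
apply: (@le_trans _ _ (a n ^+ 2 * n.+1%:R)); first by rewrite ler_wpM2l ?sqr_ge0 // ler_nat.
apply: le_trans hh _; rewrite -[leRHS]mulrA ler_wpM2l ?(ltW e2) //.
rewrite powRD; last by rewrite (gt_eqF nR) implybT.
rewrite powRr1 ?(ltW nR) // ler_pM2r //.
by rewrite (mulrC 2) powRrM powR_mulrn ?powR_ge0.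
Qed.

End Asymptotics.

Theorem mainTheorem6 (R : realType) (Omega : set 'rV[R]_3)
    (nu : 'rV[R]_3 -> 'rV[R]_3) (sigma : {measure set (borel3 R) -> \bar R})
    (lam : nat -> R[i]) (alpha : R)
    (regO : region Omega) (bndO : bounded_set Omega)
    (smoothO : smooth_boundary Omega)
    (normal_nu : outer_normal Omega nu)
    (surface_sigma : surface_measure Omega sigma)
    (eigen_lam : ordered_eigenvalues sigma (double_layer Omega nu sigma) lam)
    (halpha : - 2^-1 < alpha) :
  (lam : nat -> R[i]^o) =o_\oo (fun j : nat => (j%:R `^ alpha)%:C : R[i]^o).
Proof.
have openO : open Omega by case: regO.
have fin := surface_finite bndO smoothO surface_sigma.
have [C C0 growth] := boundary_growth bndO smoothO surface_sigma.
have [M M0 kM] := double_layer_kernel_bound openO bndO smoothO normal_nu.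
have mk := mkernel_double_layer bndO smoothO normal_nu.
have [sD _] := surface_sigma.
have [mu muE] := finite_measure_exists fin; subst sigma.
set k := double_layer_kernel Omega nu in kM mk.
have rho0 x y : 0 <= dist3 x y :> R by exact: enorm_ge0.
have rhoC (x y : borel3 R) : dist3 x y = dist3 y x by rewrite /dist3 enormBC.
have mrho := @mkernel_dist3 R.
pose V := fine (mu setT).
have V0 : 0 <= V by rewrite fine_ge0.
have kB := schur_kernel rho0 rhoC mrho C0 growth mk M0 kM.
have B0 : 0 < M * (4 * C + V) by rewrite mulr_gt0 // ltr_wpDr // mulr_gt0.
have aeD : {ae mu, forall x, boundary Omega x}.
  exists (~` boundary Omega); split => //.
  by apply: measurableC; exact: boundary_measurable.
have TE (f : borel3 R -> R[i]) z n := @iter_double_layerE R Omega nu mu f z n.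
have bound n m : (4 ^ m <= n.+1)%N -> (n.+1 < 4 ^ m.+1)%N ->
    complex.Re `|lam n| ^+ 2 * n.+1%:R <=
    (2 * M ^+ 2 * V ^+ 2 + 128 * M ^+ 2 * C ^+ 2) + (8 * M ^+ 2 * C * V) * m%:R.
  move=> l1 l2.
  have kE : k = fun x y => kfar (@dist3 R) k m x y + knear (@dist3 R) k m x y.
    by apply/funext => x; apply/funext => y; rewrite knear_kfar.
  have b0 : 0 < M * (4 * C * 2 ^- m) by rewrite !mulr_gt0 // invr_gt0 exprn_gt0.
  have A0 : 0 <= M ^+ 2 * (V + 4 * C * m%:R).
    by rewrite mulr_ge0 ?sqr_ge0 // addr_ge0 // !mulr_ge0 // ltW.
  have := eigenvalue_bound B0 kB aeD TE eigen_lam n kE (mkernel_kfar mrho mk m) b0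
    (schur_knear rho0 rhoC mrho C0 growth mk M0 kM m) A0
    (kfar_energy rho0 mrho growth mk M0 kM m).
  move=> /le_trans; apply; rewrite -/V.
  have q0 : 0 < (2 : R) ^+ m by rewrite exprn_gt0.
  (* Since n + 1 < 4^(m+1), the near contribution 2 b^2 (n + 1) stays bounded: 32 M^2 C^2 times 4 is
     the 128 M^2 C^2 of the constant. *)
  have q4 : (2 ^- m) ^+ 2 * n.+1%:R <= 4 :> R.
    rewrite exprVn mulrC ler_pdivrMr ?exprn_gt0 //.
    have : (n.+1%:R : R) <= (4 ^ m.+1)%N%:R by rewrite ler_nat ltnW.
    have -> : (4 ^ m.+1 = 4 * (2 ^ m) ^ 2)%N.
      by rewrite expnS; congr (4 * _)%N; rewrite -expnM mulnC expnM.
    by rewrite natrM natrX natrX.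
  have MC : 0 <= 32 * M ^+ 2 * C ^+ 2 by rewrite !mulr_ge0 ?(ltW M0) ?(ltW C0).
  have := ler_wpM2l MC q4.
  set q := 2 ^- m => hq.
  have -> : 2 * (M * (4 * C * q)) ^+ 2 * n.+1%:R = 32 * M ^+ 2 * C ^+ 2 * (q ^+ 2 * n.+1%:R).
    by ring.
  have -> : 2 * M ^+ 2 * V ^+ 2 + 128 * M ^+ 2 * C ^+ 2 + 8 * M ^+ 2 * C * V * m%:R =
    2 * (M ^+ 2 * (V + 4 * C * m%:R)) * V + 32 * M ^+ 2 * C ^+ 2 * 4 by ring.
  by rewrite lerD2l.
apply/eqoP => eps eps0.
(* [eps] is a positive element of [R[i]], which forces its imaginary part to vanish. *)
have epsE : eps = (complex.Re eps)%:C.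
  by move: eps0; case: eps => u v; rewrite ltcE /= => /andP[/eqP-> _].
have e0 : 0 < complex.Re eps by rewrite -ltcR -epsE.
have P0 : 0 <= 2 * M ^+ 2 * V ^+ 2 + 128 * M ^+ 2 * C ^+ 2.
  by rewrite addr_ge0 // !mulr_ge0 ?(ltW M0) ?(ltW C0).
have Q0 : 0 <= 8 * M ^+ 2 * C * V by rewrite !mulr_ge0 ?(ltW M0) ?(ltW C0).
have a0 n : 0 <= complex.Re `|lam n| by rewrite -lecR -norm_complexE normr_ge0.
have := bound_decay halpha P0 Q0 a0 bound e0.
apply: filterS => n hn.
rewrite (norm_complexE (lam n)) epsE [X in _ * X]ger0_norm ?lecR ?powR_ge0 //.
by rewrite -rmorphM lecR.
Qed.
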